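(* Let $V:=\mathbb C^{m|n}$, $\mathfrak g:=\mathfrak{gl}(V)\times\mathfrak{gl}(V)$ and $W:=V\otimes V^*$, and let $\check\rho:\mathbf U(\mathfrak g)\cong\mathbf U(\mathfrak{gl}(V))\otimes\mathbf U(\mathfrak{gl}(V))\to\mathcal{PD}(W)$ be the homomorphism given by the action of $\mathfrak g$ on $\mathcal P(W)$. Then for every integer $d\ge0$ the restrictions $$\mathbf Z^d(\mathfrak{gl}(V))\otimes1\to\mathcal{PD}^d(W)^{\mathfrak g}\qquad\text{and}\qquad 1\otimes\mathbf Z^d(\mathfrak{gl}(V))\to\mathcal{PD}^d(W)^{\mathfrak g}$$ of $\check\rho$ are surjective.
   Context: All vector spaces are over $\mathbb C$ and $\mathbb Z/2$-graded. $S(U)$ is the supersymmetric algebra of a superspace $U$ with homogeneous components $S^d(U)$, and $\mathcal P(U)=S(U^* )$. The first factor of $\mathfrak g$ acts on $V$ in the standard way and the second factor acts on $V^*$ by the contragredient action; this gives an action on $W$, $W^*$ and $\mathcal P(W)$ (by superderivations). For homogeneous $w\in W$, $\partial_w$ is the superderivation of $\mathcal P(W)$ of parity $|w|$ with $\partial_w(w^* )=(-1)^{|w|}\langle w^*,w\rangle$ for $w^*\in W^*$; $\partial_{w_1\cdots w_r}=\partial_{w_1}\cdots\partial_{w_r}$, extended linearly to $\partial_b$, $b\in S(W)$. $\mathcal{PD}(W)\subseteq\mathrm{End}_{\mathbb C}(\mathcal P(W))$ is the span of all $a\partial_b$, $a\in\mathcal P(W)$, $b\in S(W)$; $\mathcal{PD}^d(W)$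 is the span of those with $b\in\bigoplus_{r\le d}S^r(W)$. $\mathcal{PD}^d(W)^{\mathfrak g}$ consists of the operators supercommuting with the action of $\mathfrak g$. $\mathbf Z^d(\mathfrak{gl}(V)):=\mathbf Z(\mathfrak{gl}(V))\cap\mathbf U^d(\mathfrak{gl}(V))$, where $\mathbf Z(\mathfrak{gl}(V))$ is the (super)center of the enveloping algebra $\mathbf U(\mathfrak{gl}(V))$ and $\mathbf U^d$ is its standard filtration. *)

(* Defs.v *)
From HB Require Import structures.
From mathcomp Require Import all_boot all_order all_algebra.
From mathcomp Require Import boolp classical_sets functions reals.
From mathcomp Require Import ring.
From mathcomp.real_closed Require Import complex.

Set Implicit Arguments.
Unset Strict Implicit.
Unset Printing Implicit Defensive.

Import GRing.Theory.

Local Open Scope ring_scope.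
Local Open Scope quotient_scope.
Local Open Scope classical_set_scope.

(* [hpart a] is the projection onto the component of parity [a]
   ([false] = even, [true] = odd). *)
HB.mixin Record Lmodule_isSuperspace (F : fieldType) V of GRing.Lmodule F V := {
  hpart : bool -> V -> V;
  hpart_linear : forall a, linear (hpart a);
  hpartK : forall a b v, hpart a (hpart b v) = if a == b then hpart b v else 0;
  hpartD : forall v, hpart false v + hpart true v = v
}.

#[short(type="superType")]
HB.structure Definition Superspace (F : fieldType) :=
  {V of GRing.Lmodule F V & Lmodule_isSuperspace F V}.

#[short(type="superVectType")]
HB.structure Definition SuperVect (F : fieldType) :=
  {V of Vector F V & Lmodule_isSuperspace F V}.

Definition homog (F : fieldType) (V : superType F) (a : bool) (v : V) : Prop :=
  hpart a v = v.

HB.mixin Record Superspace_isLieSuperalgebra (F : fieldType) L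
    of Superspace F L := {
  sbracket : L -> L -> L;
  sbracketPl : forall c x y z,
    sbracket (c *: x + y) z = c *: sbracket x z + sbracket y z;
  sbracketPr : forall c x y z,
    sbracket x (c *: y + z) = c *: sbracket x y + sbracket x z;
  sbracket_homog : forall a b (x y : L), homog a x -> homog b y ->
    homog (a (+) b) (sbracket x y);
  sbracketC : forall a b (x y : L), homog a x -> homog b y ->
    sbracket x y = - ((-1) ^+ (a && b) *: sbracket y x);
  sjacobi : forall a b (x y z : L), homog a x -> homog b y ->
    sbracket x (sbracket y z) =
      sbracket (sbracket x y) z + (-1) ^+ (a && b) *: sbracket y (sbracket x z)
}.

#[short(type="lieSuperType")]
HB.structure Definition LieSuperalgebra (F : fieldType) :=
  {L of Superspace F L & Superspace_isLieSuperalgebra F L}.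

Section SuperspaceTheory.
Variables (F : fieldType) (V : superType F).
Implicit Types (a b : bool) (u v : V).

HB.instance Definition _ a :=
  GRing.isLinear.Build F V V *:%R (@hpart F V a) (hpart_linear a).

Lemma homog_hpart a v : homog a (hpart a v).
Proof. by rewrite /homog hpartK eqxx. Qed.

Lemma hpart_homog a b v : homog b v -> hpart a v = if a == b then v else 0.
Proof. by move=> <-; rewrite hpartK. Qed.

Lemma homog_linear a c u v : homog a u -> homog a v -> homog a (c *: u + v).
Proof. by move=> hu hv; rewrite /homog linearP /= hu hv. Qed.

Lemma homog0 a : homog a (0 : V).
Proof. exact: linear0. Qed.

Lemma super_ind (P : V -> Prop) :
  (forall u v, P u -> P v -> P (u + v)) -> (forall a v, homog a v -> P v) ->
  forall v, P v.
Proof.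
move=> PD Ph v; rewrite -(hpartD v).
by apply: PD; [apply: (Ph false)|apply: (Ph true)]; apply: homog_hpart.
Qed.

End SuperspaceTheory.

Section ProdSuper.
Variables (F : fieldType) (U V : superType F).

Definition prod_hpart a (x : U * V) : U * V := (hpart a x.1, hpart a x.2).

Fact prod_hpart_linear a : linear (prod_hpart a).
Proof. by move=> c [x y] [x' y']; rewrite /prod_hpart /= !linearP. Qed.
Fact prod_hpartK a b v :
  prod_hpart a (prod_hpart b v) = if a == b then prod_hpart b v else 0.
Proof. by rewrite /prod_hpart /= !hpartK; case: eqP. Qed.
Fact prod_hpartD v : prod_hpart false v + prod_hpart true v = v.
Proof. by case: v => x y; congr pair; rewrite /= hpartD. Qed.

HB.instance Definition _ := Lmodule_isSuperspace.Build F (U * V)%type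
  prod_hpart_linear prod_hpartK prod_hpartD.

Lemma homog_pair a (x : U) (y : V) :
  homog a (x, y) <-> homog a x /\ homog a y.
Proof.
have E : hpart a (x, y) = (hpart a x, hpart a y) by [].
by rewrite /homog E; split=> [[-> ->]|[-> ->]].
Qed.

End ProdSuper.

Section ProdLie.
Variables (F : fieldType) (L M : lieSuperType F).

Definition prod_sbracket (x y : L * M) : L * M :=
  (sbracket x.1 y.1, sbracket x.2 y.2).

Fact prod_sbracketPl c x y z :
  prod_sbracket (c *: x + y) z = c *: prod_sbracket x z + prod_sbracket y z.
Proof. by rewrite /prod_sbracket /= !sbracketPl. Qed.
Fact prod_sbracketPr c x y z :
  prod_sbracket x (c *: y + z) = c *: prod_sbracket x y + prod_sbracket x z.
Proof. by rewrite /prod_sbracket /= !sbracketPr. Qed.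
Fact prod_sbracket_homog a b (x y : L * M) : homog a x -> homog b y ->
  homog (a (+) b) (prod_sbracket x y).
Proof.
case: x y => [x x'] [y y'] /homog_pair[? ?] /homog_pair[? ?].
by apply/homog_pair; split; apply: sbracket_homog.
Qed.
Fact prod_sbracketC a b (x y : L * M) : homog a x -> homog b y ->
  prod_sbracket x y = - ((-1) ^+ (a && b) *: prod_sbracket y x).
Proof.
case: x y => [x x'] [y y'] /homog_pair[? ?] /homog_pair[? ?].
rewrite /prod_sbracket /=; congr pair; exact: sbracketC.
Qed.
Fact prod_sjacobi a b (x y z : L * M) : homog a x -> homog b y ->
  prod_sbracket x (prod_sbracket y z) =
    prod_sbracket (prod_sbracket x y) z
    + (-1) ^+ (a && b) *: prod_sbracket y (prod_sbracket x z).
Proof.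
case: x y => [x x'] [y y'] /homog_pair[? ?] /homog_pair[? ?].
rewrite /prod_sbracket /=; congr pair; exact: sjacobi.
Qed.

HB.instance Definition _ := Superspace_isLieSuperalgebra.Build F (L * M)%type
  prod_sbracketPl prod_sbracketPr prod_sbracket_homog prod_sbracketC
  prod_sjacobi.

End ProdLie.

Section Dual.
Variables (F : fieldType) (V : superVectType F).

Definition sdual := 'Hom(V, F^o).
HB.instance Definition _ := Vector.on sdual.

Definition dual_hpart a (f : sdual) : sdual := (f \o linfun (hpart a))%VF.

Lemma dual_hpartE a f v : dual_hpart a f v = f (hpart a v).
Proof. by rewrite /dual_hpart comp_lfunE lfunE. Qed.

Fact dual_hpart_linear a : linear (dual_hpart a).
Proof. by move=> c f g; apply/lfunP => v; rewrite !(dual_hpartE, add_lfunE, scale_lfunE). Qed.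
Fact dual_hpartK a b f :
  dual_hpart a (dual_hpart b f) = if a == b then dual_hpart b f else 0.
Proof.
apply/lfunP => v; rewrite !dual_hpartE hpartK eq_sym; case: eqP => [->|_].
  by rewrite dual_hpartE.
by rewrite linear0 lfunE.
Qed.
Fact dual_hpartD f : dual_hpart false f + dual_hpart true f = f.
Proof. by apply/lfunP => v; rewrite add_lfunE !dual_hpartE -linearD hpartD. Qed.

HB.instance Definition _ := Lmodule_isSuperspace.Build F sdual
  dual_hpart_linear dual_hpartK dual_hpartD.

End Dual.

(* Entry (i, j) has parity [r i (+) c j], where [r] and [c] are the parities of
   the basis vectors of the target and of the source. *)
Definition smx (F : fieldType) p q (r : 'I_p -> bool) (c : 'I_q -> bool) :=
  'M[F]_(p, q).

Section SMatrix.
Variables (F : fieldType) (p q : nat) (r : 'I_p -> bool) (c : 'I_q -> bool).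

HB.instance Definition _ := Vector.on (smx F r c).

Definition mx_hpart a (A : smx F r c) : smx F r c :=
  \matrix_(i, j) if r i (+) c j == a then A i j else 0.

Fact mx_hpart_linear a : linear (mx_hpart a).
Proof.
move=> k A B; apply/matrixP=> i j; rewrite !mxE.
by case: eqP => _; rewrite ?mulr0 ?addr0.
Qed.
Fact mx_hpartK a b A :
  mx_hpart a (mx_hpart b A) = if a == b then mx_hpart b A else 0.
Proof.
apply/matrixP=> i j; rewrite !mxE; case: (a =P b) => [->|ab].
  by rewrite mxE; case: eqP.
by rewrite mxE; case: eqP => // ->; case: eqP.
Qed.
Fact mx_hpartD A : mx_hpart false A + mx_hpart true A = A.
Proof. by apply/matrixP=> i j; rewrite !mxE; case: addb; rewrite ?addr0 ?add0r. Qed.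

HB.instance Definition _ := Lmodule_isSuperspace.Build F (smx F r c)
  mx_hpart_linear mx_hpartK mx_hpartD.

Lemma homog_mxP a (A : smx F r c) :
  homog a A <-> forall i j, r i (+) c j != a -> A i j = 0.
Proof.
split=> [<- i j /negPf rc|A0]; first by rewrite mxE rc.
by apply/matrixP=> i j; rewrite mxE; case: eqP => // /eqP /A0.
Qed.

End SMatrix.

Lemma homog_mulmx (F : fieldType) p q s (r : 'I_p -> bool) (c : 'I_q -> bool)
    (e : 'I_s -> bool) a b (A : smx F r c) (B : smx F c e) :
  homog a A -> homog b B -> homog (a (+) b) (A *m B : smx F r e).
Proof.
move=> /homog_mxP hA /homog_mxP hB; apply/homog_mxP => i j rc.
rewrite mxE big1 // => k _.
have [ra|ra] := eqVneq (r i (+) c k) a; last by rewrite hA ?mul0r.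
rewrite hB ?mulr0 //; apply: contraNneq rc => <-; rewrite -ra.
by apply/eqP; case: (r i) (c k) (e j) => [] [] [].
Qed.

Definition spar m n (i : 'I_(m + n)) : bool := (m <= i)%N.
Definition epar (i : 'I_1) : bool := false.

Section GL.
Variables (F : fieldType) (m n : nat).

Definition gl := smx F (@spar m n) (@spar m n).
HB.instance Definition _ := SuperVect.on gl.

Definition gl_bracket (x y : gl) : gl :=
  \sum_(a : bool) \sum_(b : bool) (hpart a x *m hpart b y
     - (-1) ^+ (a && b) *: (hpart b y *m hpart a x)).

Lemma gl_bracketE a b (x y : gl) : homog a x -> homog b y ->
  gl_bracket x y = x *m y - (-1) ^+ (a && b) *: (y *m x).
Proof.
move=> hx hy; rewrite /gl_bracket (bigD1 a) //= (bigD1 b) //= hx hy.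
rewrite big1 => [|b' nb]; last first.
  by rewrite (hpart_homog _ hy) (negPf nb) mulmx0 mul0mx scaler0 subr0.
rewrite big1 ?addr0 // => a' na; rewrite big1 // => b' _.
by rewrite (hpart_homog _ hx) (negPf na) mulmx0 mul0mx scaler0 subr0.
Qed.

Fact gl_bracketPl c (x y z : gl) :
  gl_bracket (c *: x + y) z = c *: gl_bracket x z + gl_bracket y z.
Proof.
rewrite /gl_bracket scaler_sumr -big_split; apply: eq_bigr => a _ /=.
rewrite scaler_sumr -big_split; apply: eq_bigr => b _ /=.
rewrite linearP /= mulmxDl mulmxDr -scalemxAl -scalemxAr scalerDr.
by rewrite scalerBr opprD addrACA !scalerA [c * _]mulrC.
Qed.
Fact gl_bracketPr c (x y z : gl) :
  gl_bracket x (c *: y + z) = c *: gl_bracket x y + gl_bracket x z.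
Proof.
rewrite /gl_bracket scaler_sumr -big_split; apply: eq_bigr => a _ /=.
rewrite scaler_sumr -big_split; apply: eq_bigr => b _ /=.
rewrite linearP /= mulmxDl mulmxDr -scalemxAl -scalemxAr scalerDr.
by rewrite scalerBr opprD addrACA !scalerA [c * _]mulrC.
Qed.
Fact gl_bracket_homog a b (x y : gl) : homog a x -> homog b y ->
  homog (a (+) b) (gl_bracket x y).
Proof.
move=> hx hy; rewrite (gl_bracketE hx hy) addrC -scaleNr.
apply: homog_linear; last exact: (homog_mulmx hx hy).
by rewrite addbC; exact: (homog_mulmx hy hx).
Qed.
Fact gl_bracketC a b (x y : gl) : homog a x -> homog b y ->
  gl_bracket x y = - ((-1) ^+ (a && b) *: gl_bracket y x).
Proof.
move=> hx hy; rewrite (gl_bracketE hx hy) (gl_bracketE hy hx) andbC.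
by rewrite scalerBr scalerA -signr_addb addbb scale1r opprB addrC.
Qed.
Fact gl_jacobi a b (x y z : gl) : homog a x -> homog b y ->
  gl_bracket x (gl_bracket y z) =
    gl_bracket (gl_bracket x y) z
    + (-1) ^+ (a && b) *: gl_bracket y (gl_bracket x z).
Proof.
move=> hx hy; move: z; apply: super_ind => [z z' IH IH'|c z hz].
  have DZ t u v : gl_bracket t (u + v) = gl_bracket t u + gl_bracket t v.
    by rewrite -[u]scale1r gl_bracketPr !scale1r.
  by rewrite !DZ IH IH' scalerDr addrACA.
rewrite (gl_bracketE hx (gl_bracket_homog hy hz)) (gl_bracketE hy hz).
rewrite (gl_bracketE (gl_bracket_homog hx hy) hz) (gl_bracketE hx hy).
rewrite (gl_bracketE hy (gl_bracket_homog hx hz)) (gl_bracketE hx hz).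
rewrite !(mulmxBr, mulmxBl) -?scalemxAl -?scalemxAr -?scalemxAl !mulmxA.
apply/matrixP => i j; rewrite !mxE.
by case: a b c {hx hy hz} => [] [] [] /=; ring.
Qed.

HB.instance Definition _ := Superspace_isLieSuperalgebra.Build F gl
  gl_bracketPl gl_bracketPr gl_bracket_homog gl_bracketC gl_jacobi.

End GL.
Section LinEnd.
Variables (F : fieldType) (A : algType F).

Record linEnd := LinEnd { linEnd_fun :> A -> A; linEndP : linear linEnd_fun }.

HB.instance Definition _ := gen_eqMixin linEnd.
HB.instance Definition _ := gen_choiceMixin linEnd.

HB.instance Definition _ (D : linEnd) :=
  GRing.isLinear.Build F A A *:%R (linEnd_fun D) (linEndP D).

Implicit Types D E : linEnd.

Lemma linEnd_ext D E : D =1 E -> D = E.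
Proof.
case: D E => [f fl] [g gl] /= /funext fg; case: _ / fg in gl *.
by congr LinEnd; apply: Prop_irrelevance.
Qed.

Fact linEnd_zero_subproof : linear (fun _ : A => 0 : A).
Proof. by move=> c x y; rewrite scaler0 addr0. Qed.
Fact linEnd_one_subproof : linear (fun x : A => x).
Proof. by []. Qed.
Fact linEnd_opp_subproof D : linear (fun x => - D x).
Proof. by move=> c x y; rewrite linearP opprD scalerN. Qed.
Fact linEnd_add_subproof D E : linear (fun x => D x + E x).
Proof. by move=> c x y; rewrite !linearP scalerDr addrACA. Qed.
Fact linEnd_mul_subproof D E : linear (fun x => D (E x)).
Proof. by move=> c x y; rewrite !linearP. Qed.
Fact linEnd_scale_subproof a D : linear (fun x => a *: D x).
Proof. by move=> c x y; rewrite linearP scalerDr !scalerA mulrC. Qed.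

Definition linEnd_zero := LinEnd linEnd_zero_subproof.
Definition linEnd_one := LinEnd linEnd_one_subproof.
Definition linEnd_opp D := LinEnd (linEnd_opp_subproof D).
Definition linEnd_add D E := LinEnd (linEnd_add_subproof D E).
Definition linEnd_mul D E := LinEnd (linEnd_mul_subproof D E).
Definition linEnd_scale a D := LinEnd (linEnd_scale_subproof a D).

Fact linEnd_addA : associative linEnd_add.
Proof. by move=> ? ? ?; apply: linEnd_ext => x; rewrite /= addrA. Qed.
Fact linEnd_addC : commutative linEnd_add.
Proof. by move=> ? ?; apply: linEnd_ext => x; rewrite /= addrC. Qed.
Fact linEnd_add0 : left_id linEnd_zero linEnd_add.
Proof. by move=> ?; apply: linEnd_ext => x; rewrite /= add0r. Qed.
Fact linEnd_addN : left_inverse linEnd_zero linEnd_opp linEnd_add.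
Proof. by move=> ?; apply: linEnd_ext => x; rewrite /= addNr. Qed.

HB.instance Definition _ := GRing.isZmodule.Build linEnd
  linEnd_addA linEnd_addC linEnd_add0 linEnd_addN.

Fact linEnd_mulA : associative linEnd_mul.
Proof. by move=> ? ? ?; apply: linEnd_ext. Qed.
Fact linEnd_mul1 : left_id linEnd_one linEnd_mul.
Proof. by move=> ?; apply: linEnd_ext. Qed.
Fact linEnd_mulr1 : right_id linEnd_one linEnd_mul.
Proof. by move=> ?; apply: linEnd_ext. Qed.
Fact linEnd_mulDl : left_distributive linEnd_mul +%R.
Proof. by move=> ? ? ?; apply: linEnd_ext. Qed.
Fact linEnd_mulDr : right_distributive linEnd_mul +%R.
Proof. by move=> ? ? ?; apply: linEnd_ext => x; rewrite /= linearD. Qed.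
Fact linEnd_one_neq0 : linEnd_one != 0.
Proof.
apply/eqP => /(congr1 (fun D : linEnd => D 1)) /= /eqP.
by rewrite oner_eq0.
Qed.

HB.instance Definition _ := GRing.Zmodule_isNzRing.Build linEnd
  linEnd_mulA linEnd_mul1 linEnd_mulr1 linEnd_mulDl linEnd_mulDr
  linEnd_one_neq0.

Fact linEnd_scaleA a b D : linEnd_scale a (linEnd_scale b D) = linEnd_scale (a * b) D.
Proof. by apply: linEnd_ext => x; rewrite /= scalerA. Qed.
Fact linEnd_scale1 : left_id 1 linEnd_scale.
Proof. by move=> ?; apply: linEnd_ext => x; rewrite /= scale1r. Qed.
Fact linEnd_scaleDr : right_distributive linEnd_scale +%R.
Proof. by move=> ? ? ?; apply: linEnd_ext => x; rewrite /= scalerDr. Qed.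
Fact linEnd_scaleDl D : {morph linEnd_scale^~ D : a b / a + b}.
Proof. by move=> ? ?; apply: linEnd_ext => x; rewrite /= scalerDl. Qed.

HB.instance Definition _ := GRing.Zmodule_isLmodule.Build F linEnd
  linEnd_scaleA linEnd_scale1 linEnd_scaleDr linEnd_scaleDl.

Fact linEnd_scaleAl a D E : a *: (D * E) = (a *: D) * E.
Proof. by apply: linEnd_ext. Qed.
HB.instance Definition _ := GRing.Lmodule_isLalgebra.Build F linEnd
  linEnd_scaleAl.
Fact linEnd_scaleAr a D E : a *: (D * E) = D * (a *: E).
Proof. by apply: linEnd_ext => x; rewrite /= linearZ. Qed.
HB.instance Definition _ := GRing.Lalgebra_isAlgebra.Build F linEnd
  linEnd_scaleAr.

Lemma linEndD D E f : (D + E) f = D f + E f. Proof. by []. Qed.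
Lemma linEndZ c D f : (c *: D) f = c *: D f. Proof. by []. Qed.
Lemma linEndM D E f : (D * E) f = D (E f). Proof. by []. Qed.

End LinEnd.

Section Presentation.
Variables (F : fieldType) (L : superType F) (br : L -> L -> L).

Inductive aexpr :=
  | AGen of L
  | ACst of F
  | AAdd of aexpr & aexpr
  | AMul of aexpr & aexpr.

(* The least congruence making expressions an associative unital F-algebra in
   which [AGen] is linear and x y = (-1)^(|x||y|) y x + [x, y] for homogeneous
   generators. *)
Inductive acong : aexpr -> aexpr -> Prop :=
  | acong_refl s : acong s s
  | acong_sym s t : acong s t -> acong t s
  | acong_trans s t u : acong s t -> acong t u -> acong s u
  | acong_add s s' t t' :
      acong s s' -> acong t t' -> acong (AAdd s t) (AAdd s' t')
  | acong_mul s s' t t' :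
      acong s s' -> acong t t' -> acong (AMul s t) (AMul s' t')
  | acong_addA s t u : acong (AAdd s (AAdd t u)) (AAdd (AAdd s t) u)
  | acong_addC s t : acong (AAdd s t) (AAdd t s)
  | acong_add0 s : acong (AAdd (ACst 0) s) s
  | acong_addN s : acong (AAdd (AMul (ACst (-1)) s) s) (ACst 0)
  | acong_mulA s t u : acong (AMul s (AMul t u)) (AMul (AMul s t) u)
  | acong_mul1 s : acong (AMul (ACst 1) s) s
  | acong_mulDl s t u :
      acong (AMul (AAdd s t) u) (AAdd (AMul s u) (AMul t u))
  | acong_mulDr s t u :
      acong (AMul s (AAdd t u)) (AAdd (AMul s t) (AMul s u))
  | acong_cstC a s : acong (AMul (ACst a) s) (AMul s (ACst a))
  | acong_cstD a b : acong (AAdd (ACst a) (ACst b)) (ACst (a + b))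
  | acong_cstM a b : acong (AMul (ACst a) (ACst b)) (ACst (a * b))
  | acong_lin a x y :
      acong (AGen (a *: x + y)) (AAdd (AMul (ACst a) (AGen x)) (AGen y))
  | acong_br a b x y : homog a x -> homog b y ->
      acong (AMul (AGen x) (AGen y))
            (AAdd (AMul (ACst ((-1) ^+ (a && b))) (AMul (AGen y) (AGen x)))
                  (AGen (br x y))).

HB.instance Definition _ := gen_eqMixin aexpr.
HB.instance Definition _ := gen_choiceMixin aexpr.

Definition acongb (s t : aexpr) : bool := `[< acong s t >].

Fact acongb_equiv : equiv_class_of acongb.
Proof.
split=> [s|s t|t s u]; first exact/asboolP/acong_refl.
  by apply/asboolP/asboolP; apply: acong_sym.
by move=> /asboolP st /asboolP tu; apply/asboolP; apply: acong_trans st tu.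
Qed.
Canonical acong_equiv := EquivRelPack acongb_equiv.

Definition envel := {eq_quot acong_equiv}.
HB.instance Definition _ := Choice.on envel.
HB.instance Definition _ := EqQuotient.on envel.

Implicit Types s t : aexpr.

Definition acls s : envel := \pi s.

Let clsP s t : acong s t -> acls s = acls t.
Proof. by move=> st; apply/eqP; rewrite eqmodE; apply/asboolP. Qed.

Let cls_cong s t : acls s = acls t -> acong s t.
Proof. by move=> /eqP; rewrite eqmodE => /asboolP. Qed.

Let repr_cong s : acong (repr (acls s)) s.
Proof. by apply: cls_cong; rewrite /acls reprK. Qed.

Let clsW (P : envel -> Prop) : (forall s, P (acls s)) -> forall z, P z.
Proof. by move=> PP z; rewrite -[z]reprK. Qed.

Definition envel_cst a : envel := acls (ACst a).
Definition envel_add (x y : envel) : envel := acls (AAdd (repr x) (repr y)).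
Definition envel_mul (x y : envel) : envel := acls (AMul (repr x) (repr y)).
Definition envel_opp (x : envel) : envel := envel_mul (envel_cst (-1)) x.
Definition envel_scale a (x : envel) : envel := envel_mul (envel_cst a) x.
Definition envel_gen (x : L) : envel := acls (AGen x).

Let addE s t : envel_add (acls s) (acls t) = acls (AAdd s t).
Proof. by apply: clsP; apply: acong_add. Qed.
Let mulE s t : envel_mul (acls s) (acls t) = acls (AMul s t).
Proof. by apply: clsP; apply: acong_mul. Qed.
Let cstE a : envel_cst a = acls (ACst a). Proof. by []. Qed.
Let E := (cstE, addE, mulE).

Fact envel_addA : associative envel_add.
Proof.
by elim/clsW=> s; elim/clsW=> t; elim/clsW=> u; rewrite !E; apply/clsP/acong_addA.
Qed.
Fact envel_addC : commutative envel_add.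
Proof. by elim/clsW=> s; elim/clsW=> t; rewrite !E; apply/clsP/acong_addC. Qed.
Fact envel_add0 : left_id (envel_cst 0) envel_add.
Proof. by elim/clsW=> s; rewrite !E; apply/clsP/acong_add0. Qed.
Fact envel_addN : left_inverse (envel_cst 0) envel_opp envel_add.
Proof. by elim/clsW=> s; rewrite /envel_opp !E; apply/clsP/acong_addN. Qed.

HB.instance Definition _ := GRing.isZmodule.Build envel
  envel_addA envel_addC envel_add0 envel_addN.

Fact envel_mulA : associative envel_mul.
Proof.
by elim/clsW=> s; elim/clsW=> t; elim/clsW=> u; rewrite !E; apply/clsP/acong_mulA.
Qed.
Fact envel_mul1 : left_id (envel_cst 1) envel_mul.
Proof. by elim/clsW=> s; rewrite !E; apply/clsP/acong_mul1. Qed.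
Fact envel_cstC a x : envel_mul (envel_cst a) x = envel_mul x (envel_cst a).
Proof. by elim/clsW: x => s; rewrite !E; apply/clsP/acong_cstC. Qed.
Fact envel_mulr1 : right_id (envel_cst 1) envel_mul.
Proof. by move=> s; rewrite -envel_cstC envel_mul1. Qed.
Fact envel_mulDl : left_distributive envel_mul envel_add.
Proof.
by elim/clsW=> s; elim/clsW=> t; elim/clsW=> u; rewrite !E; apply/clsP/acong_mulDl.
Qed.
Fact envel_mulDr : right_distributive envel_mul envel_add.
Proof.
by elim/clsW=> s; elim/clsW=> t; elim/clsW=> u; rewrite !E; apply/clsP/acong_mulDr.
Qed.

Definition br_compat (A : algType F) (f : L -> A) : Prop :=
  forall a b x y, homog a x -> homog b y ->
    f x * f y = (-1) ^+ (a && b) *: (f y * f x) + f (br x y).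

Section Eval.
Variables (A : algType F) (f : {linear L -> A}).
Hypothesis f_br : br_compat f.

Fixpoint aeval s : A := match s with
  | AGen x => f x
  | ACst a => a%:A
  | AAdd s t => aeval s + aeval t
  | AMul s t => aeval s * aeval t
  end.

Lemma aeval_cong s t : acong s t -> aeval s = aeval t.
Proof.
elim=> //= {s t}.
- by move=> s t u _ -> _ ->.
- by move=> s s' t t' _ -> _ ->.
- by move=> s s' t t' _ -> _ ->.
- by move=> s t u; rewrite addrA.
- by move=> s t; rewrite addrC.
- by move=> s; rewrite scale0r add0r.
- by move=> s; rewrite scaleN1r mulN1r addNr scale0r.
- by move=> s t u; rewrite mulrA.
- by move=> s; rewrite scale1r mul1r.
- by move=> s t u; rewrite mulrDl.
- by move=> s t u; rewrite mulrDr.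
- by move=> a s; rewrite -scalerAl -scalerAr mul1r mulr1.
- by move=> a b; rewrite scalerDl.
- by move=> a b; rewrite -scalerAl mul1r scalerA.
- by move=> a x y; rewrite linearP -scalerAl mul1r.
- by move=> a b x y hx hy; rewrite (f_br hx hy) -scalerAl mul1r.
Qed.

Definition envel_eval (z : envel) : A := aeval (repr z).

Let evalE s : envel_eval (acls s) = aeval s.
Proof. exact: aeval_cong. Qed.

Let eval_add x y : envel_eval (envel_add x y) = envel_eval x + envel_eval y.
Proof. by elim/clsW: x => s; elim/clsW: y => t; rewrite addE !evalE. Qed.
Let eval_mul x y : envel_eval (envel_mul x y) = envel_eval x * envel_eval y.
Proof. by elim/clsW: x => s; elim/clsW: y => t; rewrite mulE !evalE. Qed.
Let eval_cst a : envel_eval (envel_cst a) = a%:A.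
Proof. by rewrite cstE evalE. Qed.
Let eval_gen x : envel_eval (envel_gen x) = f x.
Proof. exact: evalE. Qed.

Definition envel_evalE := (eval_add, eval_mul, eval_cst, eval_gen).

End Eval.
Fact envel_one_neq0 : envel_cst 1 != 0.
Proof.
have z_lin : linear (fun _ : L => 0 : F^o) by move=> c x y; rewrite scaler0 addr0.
pose z : {linear L -> F^o} := HB.pack (fun _ : L => 0 : F^o)
  (GRing.isLinear.Build F L F^o *:%R _ z_lin).
have z_br : br_compat z.
  by move=> a b x y _ _; rewrite mulr0 scaler0 addr0.
apply/eqP => /(congr1 (envel_eval z)).
have e c : envel_eval z (envel_cst c) = c%:A by rewrite (envel_evalE z_br).
by rewrite (e 1) (e 0) scale1r scale0r => /eqP; rewrite oner_eq0.
Qed.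

HB.instance Definition _ := GRing.Zmodule_isNzRing.Build envel
  envel_mulA envel_mul1 envel_mulr1 envel_mulDl envel_mulDr envel_one_neq0.

Fact envel_scaleA a b x :
  envel_scale a (envel_scale b x) = envel_scale (a * b) x.
Proof.
by elim/clsW: x => s; rewrite /envel_scale envel_mulA !E; apply: clsP;
   apply: acong_mul (acong_refl _); apply: acong_cstM.
Qed.
Fact envel_scale1 : left_id 1 envel_scale.
Proof. exact: envel_mul1. Qed.
Fact envel_scaleDr : right_distributive envel_scale +%R.
Proof. by move=> a x y; apply: envel_mulDr. Qed.
Fact envel_scaleDl x : {morph envel_scale^~ x : a b / a + b}.
Proof.
move=> a b; rewrite [RHS](esym (envel_mulDl _ _ _)); congr envel_mul.
by rewrite [RHS]addE; apply/clsP/acong_sym/acong_cstD.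
Qed.

HB.instance Definition _ := GRing.Zmodule_isLmodule.Build F envel
  envel_scaleA envel_scale1 envel_scaleDr envel_scaleDl.

Fact envel_scaleAl a (x y : envel) : a *: (x * y) = (a *: x) * y.
Proof. exact: envel_mulA. Qed.
HB.instance Definition _ := GRing.Lmodule_isLalgebra.Build F envel
  envel_scaleAl.
Fact envel_scaleAr a (x y : envel) : a *: (x * y) = x * (a *: y).
Proof.
by rewrite [LHS]envel_mulA [envel_mul _ x]envel_cstC -[LHS]envel_mulA.
Qed.
HB.instance Definition _ := GRing.Lalgebra_isAlgebra.Build F envel
  envel_scaleAr.

Fact envel_gen_linear : linear envel_gen.
Proof.
move=> a x y; rewrite [LHS](clsP (acong_lin a x y)).
by rewrite -addE -mulE.
Qed.
HB.instance Definition _ :=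
  GRing.isLinear.Build F L envel *:%R envel_gen envel_gen_linear.

Lemma envel_rel a b x y : homog a x -> homog b y ->
  envel_gen x * envel_gen y =
    (-1) ^+ (a && b) *: (envel_gen y * envel_gen x) + envel_gen (br x y).
Proof.
move=> hx hy; rewrite [LHS]mulE [LHS](clsP (acong_br hx hy)).
by rewrite -addE -mulE -[acls (AMul _ _)]mulE.
Qed.

Lemma envel_ind (P : envel -> Prop) :
  (forall x, P (envel_gen x)) -> (forall a, P a%:A) ->
  (forall x y, P x -> P y -> P (x + y)) ->
  (forall x y, P x -> P y -> P (x * y)) -> forall z, P z.
Proof.
move=> Pg Pc Pa Pm; apply: clsW; elim=> [x|a|s Ps t Pt|s Ps t Pt].
- exact: Pg.
- have <- : a%:A = acls (ACst a) :> envel by apply: envel_mulr1.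
  exact: Pc.
- by rewrite -addE; apply: Pa.
- by rewrite -mulE; apply: Pm.
Qed.

Section Lift.
Variables (A : algType F) (f : {linear L -> A}).

Definition envel_lift of br_compat f : envel -> A := envel_eval f.

Hypothesis f_br : br_compat f.

Fact envel_lift_linear : linear (envel_lift f_br).
Proof.
move=> a x y; rewrite /envel_lift [LHS](envel_evalE f_br).
by rewrite [envel_eval _ (a *: x)](envel_evalE f_br) (envel_evalE f_br)
           -scalerAl mul1r.
Qed.
Fact envel_lift_monoid : monoid_morphism (envel_lift f_br).
Proof.
split=> [|x y]; last by rewrite [LHS](envel_evalE f_br).
by rewrite [LHS](envel_evalE f_br) scale1r.
Qed.
HB.instance Definition _ := GRing.isLinear.Build F envel A *:%R
  (envel_lift f_br) envel_lift_linear.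
HB.instance Definition _ := GRing.isMonoidMorphism.Build envel A
  (envel_lift f_br) envel_lift_monoid.

Lemma envel_lift_gen x : envel_lift f_br (envel_gen x) = f x.
Proof. by rewrite [LHS](envel_evalE f_br). Qed.

Lemma envel_lift_unique (g : {lrmorphism envel -> A}) :
  (forall x, g (envel_gen x) = f x) -> g =1 envel_lift f_br.
Proof.
move=> gf; apply: envel_ind => [x|a|x y gx gy|x y gx gy].
- by rewrite gf envel_lift_gen.
- by rewrite [LHS]linearZ [RHS]linearZ; congr (_ *: _); rewrite !rmorph1.
- by rewrite [LHS]linearD [RHS]linearD; congr (_ + _).
- by rewrite [LHS]rmorphM [RHS]rmorphM; congr (_ * _).
Qed.

End Lift.

(* The Z/2-grading for which [envel_gen] preserves parity. *)
Inductive envel_homog : bool -> envel -> Prop :=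
  | envel_homog_gen a x : homog a x -> envel_homog a (envel_gen x)
  | envel_homog_cst c : envel_homog false c%:A
  | envel_homog0 a : envel_homog a 0
  | envel_homogD a x y :
      envel_homog a x -> envel_homog a y -> envel_homog a (x + y)
  | envel_homogM a b x y :
      envel_homog a x -> envel_homog b y -> envel_homog (a (+) b) (x * y).

Lemma envel_homogZ a c x : envel_homog a x -> envel_homog a (c *: x).
Proof.
move=> hx; rewrite -[x]mul1r scalerAl.
exact: (envel_homogM (envel_homog_cst c) hx).
Qed.

Lemma envel_homog_sum z :
  exists z0 z1, [/\ envel_homog false z0, envel_homog true z1 & z = z0 + z1].
Proof.
elim/envel_ind: z => [x|c|z t|z t].
- exists (envel_gen (hpart false x)), (envel_gen (hpart true x)).
  by rewrite -linearD hpartD; split=> //; apply/envel_homog_gen/homog_hpart.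
- exists c%:A, 0; rewrite addr0.
  by split=> //; [apply: envel_homog_cst | apply: envel_homog0].
- move=> [z0 [z1 [h0 h1 ->]]] [t0 [t1 [k0 k1 ->]]].
  by exists (z0 + t0), (z1 + t1); rewrite addrACA; split=> //; apply: envel_homogD.
- move=> [z0 [z1 [h0 h1 ->]]] [t0 [t1 [k0 k1 ->]]].
  exists (z0 * t0 + z1 * t1), (z0 * t1 + z1 * t0); split.
  + apply: envel_homogD; first exact: (envel_homogM h0 k0).
    exact: (envel_homogM h1 k1).
  + apply: envel_homogD; first exact: (envel_homogM h0 k1).
    exact: (envel_homogM h1 k0).
  + rewrite mulrDl !mulrDr -!addrA; congr (_ + _).
    by rewrite [RHS]addrC -addrA.
Qed.

End Presentation.

Section Span.
Variables (F : fieldType) (A : lmodType F).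
Definition lspan (S : set A) : set A := [set x | exists s : seq (F * A),
  (forall p, p \in s -> S p.2) /\ x = \sum_(p <- s) p.1 *: p.2].
End Span.

Section Filtration.
Variables (F : fieldType) (L : superType F) (br : L -> L -> L).

(* Span of the products of at most [d] generators: U^d(L) when [br] is the
   bracket of L, the sum of the S^r(L) with r <= d when [br] = 0. *)
Definition envel_filt (d : nat) : set (envel br) :=
  lspan [set z | exists s : seq L,
    (size s <= d)%N /\ z = \prod_(x <- s) envel_gen br x].

End Filtration.
Section Ssym.
Variables (F : fieldType) (U : superType F).

(* [S(U)], the tensor algebra modulo x y = (-1)^(|x||y|) y x. *)
Definition ssym := envel (fun _ _ : U => 0).
HB.instance Definition _ := GRing.Algebra.on ssym.

Definition sgen : U -> ssym := envel_gen (fun _ _ : U => 0).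
HB.instance Definition _ := GRing.Linear.on sgen.

Lemma sgenC a b x y : homog a x -> homog b y ->
  sgen x * sgen y = (-1) ^+ (a && b) *: (sgen y * sgen x).
Proof.
by move=> hx hy; rewrite [LHS](envel_rel _ hx hy) [envel_gen _ 0]linear0 addr0.
Qed.

Lemma sign_andDr (a b c : bool) :
  (-1) ^+ (a && (b (+) c)) = (-1) ^+ (a && b) * (-1) ^+ (a && c) :> F.
Proof. by case: a b c => [] [] []; rewrite /= ?(expr0, expr1, mulr1, mul1r, mulN1r, opprK). Qed.

Lemma sign_andDl (a b c : bool) :
  (-1) ^+ ((a (+) b) && c) = (-1) ^+ (a && c) * (-1) ^+ (b && c) :> F.
Proof. by rewrite ![_ && c]andbC sign_andDr. Qed.

Lemma ssymC a b (f g : ssym) : envel_homog a f -> envel_homog b g ->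
  f * g = (-1) ^+ (a && b) *: (g * f).
Proof.
move=> hf hg; elim: hf => {a f} [a x hx|c|a|a f h _ IHf _ IHh|a a' f h _ IHf _ IHh].
- elim: hg => {b g} [b y hy|c|b|b g h _ IHg _ IHh|b b' g h _ IHg _ IHh].
  + exact: sgenC.
  + by rewrite andbF scale1r -scalerAl -scalerAr mul1r mulr1.
  + by rewrite mulr0 mul0r scaler0.
  + by rewrite mulrDr mulrDl scalerDr IHg IHh.
  + rewrite mulrA IHg -scalerAl -mulrA IHh -scalerAr scalerA -mulrA.
    by rewrite sign_andDr.
- by rewrite scale1r -scalerAl -scalerAr mul1r mulr1.
- by rewrite mulr0 mul0r scaler0.
- by rewrite mulrDr mulrDl scalerDr IHf IHh.
- rewrite -mulrA IHh -scalerAr mulrA IHf -scalerAl scalerA -mulrA.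
  by rewrite sign_andDl mulrC.
Qed.

Implicit Types D E : linEnd ssym.

Definition superder (p : bool) D : Prop := forall a f g, envel_homog a f ->
  D (f * g) = D f * g + (-1) ^+ (p && a) *: (f * D g).

Definition op_homog (p : bool) D : Prop :=
  forall a f, envel_homog a f -> envel_homog (p (+) a) (D f).

Lemma superder1 p D : superder p D -> D 1 = 0.
Proof.
move=> /(_ false 1 1); rewrite -[X in envel_homog _ X]scale1r.
move=> /(_ (envel_homog_cst _ 1)); rewrite andbF scale1r !mulr1 mul1r.
by move=> /eqP; rewrite -subr_eq subrr eq_sym => /eqP.
Qed.

Lemma superder_homog p D : superder p D ->
  (forall a u, homog a u -> envel_homog (p (+) a) (D (sgen u))) ->
  op_homog p D.
Proof.
move=> Dp Dg a f; elim=> {a f} [a x hx|c|a|a f h _ IHf _ IHh|a b f h hf IHf hh IHh].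
- exact: Dg.
- by rewrite linearZ /= (superder1 Dp) scaler0; apply: envel_homog0.
- by rewrite linear0; apply: envel_homog0.
- by rewrite linearD; apply: envel_homogD.
- rewrite (Dp _ _ _ hf); apply: envel_homogD.
    by rewrite addbA; apply: envel_homogM.
  by apply: envel_homogZ; rewrite addbCA; apply: envel_homogM.
Qed.

Lemma superder_ext p D E : superder p D -> superder p E ->
  (forall u, D (sgen u) = E (sgen u)) -> D = E.
Proof.
move=> Dp Ep DE; apply: linEnd_ext.
suff hom a f : envel_homog a f -> D f = E f.
  move=> f; have [f0 [f1 [h0 h1 ->]]] := envel_homog_sum f.
  by rewrite !linearD /= (hom _ _ h0) (hom _ _ h1).
elim=> {a f} [a x hx|c|a|a f h _ IHf _ IHh|a b f h hf IHf hh IHh].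
- exact: DE.
- by rewrite !linearZ /= (superder1 Dp) (superder1 Ep).
- by rewrite !linear0.
- by rewrite !linearD /= IHf IHh.
- by rewrite (Dp _ _ _ hf) (Ep _ _ _ hf) IHf IHh.
Qed.

Lemma superder_lin p c D E : superder p D -> superder p E ->
  superder p (c *: D + E).
Proof.
move=> Dp Ep a f g hf; rewrite !(linEndD, linEndZ) (Dp _ _ _ hf) (Ep _ _ _ hf).
rewrite mulrDl mulrDr !scalerDr -scalerAl -scalerAr addrACA.
by rewrite !scalerA mulrC.
Qed.

Lemma superder_comm p q D E :
  superder p D -> op_homog p D -> superder q E -> op_homog q E ->
  superder (p (+) q) (D * E - (-1) ^+ (p && q) *: (E * D)).
Proof.
move=> Dp Dh Eq Eh a f g hf.
have NE (A B : linEnd ssym) h : (A - B) h = A h - B h by [].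
rewrite !NE !linEndZ !linEndM (Eq _ _ _ hf) (Dp _ _ _ hf) !linearD !linearZ /=.
rewrite (Dp _ _ _ hf) (Eq _ _ _ hf) (Dp _ _ _ (Eh _ _ hf)) (Eq _ _ _ (Dh _ _ hf)).
rewrite !(mulrBl, mulrBr, scalerDr, scalerBr) -?scalerAl -?scalerAr !scalerA.
rewrite sign_andDl !sign_andDr.
set s := (-1) ^+ (p && a); set t := (-1) ^+ (q && a).
rewrite [q && p]andbC; set r := (-1) ^+ (p && q).
have rr : r * r = 1 by rewrite -signr_addb addbb.
rewrite !(mulrBl, mulrBr, mulrDl, mulrDr, scalerDr, scalerBr) -?scalerAl -?scalerAr !scalerA.
rewrite !mulrN1 !mulrN !mulNr !scaleNr !addrA.
have -> : r * (r * t) = t by rewrite mulrA rr mul1r.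
rewrite [LHS](ACl ((2*7)*(3*6)*((1*5)*(4*8)))).
rewrite /= !subrr !add0r -[r * s * t]mulrA [r * (s * t)]mulrC [t * s]mulrC.
by rewrite !addrA.
Qed.

Section Existence.
Variables (p : bool) (d : {linear U -> ssym}).
Hypothesis d_homog : forall a u, homog a u -> envel_homog (p (+) a) (d u).

(* A superderivation is read off an algebra morphism to triangular matrices,
   f |-> ((-1)^(p|f|) f, D f; 0, f). *)
Let sg u : ssym := sgen (hpart false u + (-1) ^+ p *: hpart true u).

Let sg_linear : linear sg.
Proof.
move=> c u v; rewrite -[RHS]linearP; congr sgen.
rewrite ![hpart _ (_ + _)]linearP !scalerDr !scalerA addrACA.
by rewrite [c * _]mulrC.
Qed.

Let tri_fun u (v : ssym * ssym) : ssym * ssym :=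
  (sg u * v.1 + d u * v.2, sgen u * v.2).

Let tri_lin u : linear (tri_fun u).
Proof.
move=> c [x y] [x' y']; congr pair => /=.
  by rewrite !mulrDr !scalerDr -!scalerAr addrACA.
by rewrite mulrDr scalerAr.
Qed.

Let tri u : linEnd (ssym * ssym)%type := LinEnd (tri_lin u).

Let tri_linear : linear tri.
Proof.
move=> c u v; apply: linEnd_ext => -[x y]; congr pair => /=; last first.
  by rewrite linearP mulrDl scalerAl.
by rewrite sg_linear [d _]linearP !mulrDl scalerDr -!scalerAl addrACA.
Qed.

HB.instance Definition _ := GRing.isLinear.Build F U (linEnd (ssym * ssym)%type) *:%R tri tri_linear.

Let triE a u : homog a u -> forall v,
  tri u v = ((-1) ^+ (p && a) *: (sgen u * v.1) + d u * v.2, sgen u * v.2).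
Proof.
move=> hu v; congr (_ + _, _); rewrite /sg !(hpart_homog _ hu).
case: a {hu}; rewrite /= ?(andbT, andbF) ?add0r ?scaler0 ?addr0 ?scale1r //.
by rewrite linearZ scalerAl.
Qed.

Let tri_br : br_compat (fun _ _ : U => 0) tri.
Proof.
move=> a b x y hx hy; apply: linEnd_ext => v.
have tri0 : tri 0 = 0 by apply: linear0.
rewrite tri0 addr0 linEndZ !linEndM !(triE hx, triE hy).
have dxC := ssymC (d_homog hx) (envel_homog_gen _ hy).
have dyC := ssymC (d_homog hy) (envel_homog_gen _ hx).
rewrite -/(sgen _) -/(sgen _) in dxC dyC.
congr pair => /=; last first.
  by rewrite !mulrA (sgenC hx hy) -scalerAl.
rewrite !mulrDr !scalerDr -!scalerAr !mulrA dxC dyC (sgenC hx hy).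
rewrite -!scalerAl !scalerA !sign_andDl [b && a]andbC -!addrA.
have ss (c : bool) : (-1) ^+ c * (-1) ^+ c = 1 :> F by rewrite -signr_addb addbb.
congr (_ + _); first by congr (_ *: _); ring.
rewrite addrC; congr (_ *: _ + _ *: _); first by ring.
by rewrite mulrCA ss mulr1.
Qed.

Let Phi := envel_lift tri_br.

Let PhiE : (forall u, Phi (sgen u) = tri u) * (forall c, Phi c%:A = c *: 1) *
  (forall f g v, Phi (f + g) v = Phi f v + Phi g v) *
  (forall f g v, Phi (f * g) v = Phi f (Phi g v)).
Proof.
split; [split; [split|]|] => [u|c|f g v|f g v].
- exact: envel_lift_gen.
- by rewrite /Phi linearZ rmorph1.
- by rewrite /Phi linearD.
- by rewrite /Phi rmorphM.
Qed.

Let Phi_snd f v : (Phi f v).2 = f * v.2.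
Proof.
elim/envel_ind: f v => [u|c|f g IHf IHg|f g IHf IHg] v.
- by rewrite PhiE.
- by rewrite PhiE /= -scalerAl mul1r.
- by rewrite PhiE /= IHf IHg mulrDl.
- by rewrite PhiE IHf IHg mulrA.
Qed.

Let Phi_mulr f v w :
  Phi f (v.1 * w, v.2 * w) = ((Phi f v).1 * w, (Phi f v).2 * w).
Proof.
elim/envel_ind: f v => [u|c|f g IHf IHg|f g IHf IHg] v.
- by rewrite PhiE; congr pair; rewrite /= ?mulrDl !mulrA.
- by rewrite PhiE; congr pair; rewrite /= scalerAl.
- by rewrite PhiE IHf IHg PhiE; congr pair; rewrite /= mulrDl.
- by rewrite !PhiE IHg IHf.
Qed.

Let Phi_fst a f v : envel_homog a f ->
  Phi f (v, 0) = ((-1) ^+ (p && a) *: (f * v), 0).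
Proof.
move=> hf; rewrite [LHS]surjective_pairing Phi_snd mulr0; congr pair.
elim: hf v => {a f} [a x hx|c|a|a f h _ IHf _ IHh|a b f h _ IHf _ IHh] v.
- by rewrite PhiE (triE hx) /= mulr0 addr0.
- by rewrite PhiE /= andbF scale1r -scalerAl mul1r.
- by rewrite /Phi linear0 mul0r scaler0.
- by rewrite PhiE /= IHf IHh mulrDl scalerDr.
- rewrite PhiE [Phi h _]surjective_pairing Phi_snd mulr0 IHh IHf.
  by rewrite -scalerAr scalerA mulrA sign_andDr.
Qed.

Lemma superder_exists : exists D, superder p D /\ forall u, D (sgen u) = d u.
Proof.
have D_lin : linear (fun f : ssym => (Phi f (0, 1)).1).
  by move=> c f g; rewrite /Phi linearP.
exists (LinEnd D_lin); split=> [a f g hf|u] /=; last first.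
  by rewrite PhiE /= mulr0 add0r mulr1.
have -> : Phi (f * g) (0, 1) =
    Phi f ((Phi g (0, 1)).1, 0) + Phi f (0 * g, 1 * g).
  rewrite PhiE -linearD [Phi g _]surjective_pairing Phi_snd.
  by congr (Phi f (_, _)); rewrite /= ?mul0r ?addr0 ?add0r ?mul1r ?mulr1.
by rewrite (Phi_fst _ hf) (Phi_mulr f (0, 1)) /= addrC.
Qed.

End Existence.

(* The superderivation of parity [p] extending [d]. *)
Definition sder (p : bool) (d : U -> ssym) : linEnd ssym :=
  xget 0 [set D | superder p D /\ forall u, D (sgen u) = d u].

Lemma sderP p d : linear d ->
  (forall a u, homog a u -> envel_homog (p (+) a) (d u)) ->
  superder p (sder p d) /\ forall u, sder p d (sgen u) = d u.
Proof.
move=> dlin dh; pose d' : {linear U -> ssym} := HB.pack d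
  (GRing.isLinear.Build F U ssym *:%R d dlin).
have [D HD] := @superder_exists p d' dh.
by rewrite /sder; case: xgetP => [E _ //|/(_ D)].
Qed.

End Ssym.
Section FamDer.
Variables (F : fieldType) (X U : superType F) (d : X -> U -> ssym U).

(* The superderivations [D_x] with [D_x u = d x u], of parity [|x|] when [x] is
   homogeneous, extended linearly in [x]. *)
Definition famder (x : X) : linEnd (ssym U) :=
  \sum_(a : bool) sder a (d (hpart a x)).

Hypothesis dl : forall u, linear (d^~ u).
Hypothesis dr : forall x, linear (d x).
Hypothesis dh : forall a b x u,
  homog a x -> homog b u -> envel_homog (a (+) b) (d x u).

Let sderaP a x := sderP (dr (hpart a x)) (fun b u => dh (homog_hpart a x)).

Let famderE x : famder x = sder false (d (hpart false x)) + sder true (d (hpart true x)).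
Proof. by rewrite /famder big_bool addrC. Qed.

Lemma famder_gen x u : famder x (sgen u) = d x u.
Proof.
rewrite famderE linEndD (sderaP false x).2 (sderaP true x).2 -[in RHS](hpartD x).
by have := dl u 1 (hpart false x) (hpart true x); rewrite /= !scale1r.
Qed.

Let d0 u : d 0 u = 0.
Proof. by have := dl u (-1) 0 0; rewrite /= !scaleN1r oppr0 addr0 addNr. Qed.

Let sder0 a : sder a (d 0) = 0 :> linEnd (ssym U).
Proof.
have h0 b (u : U) : homog b u -> envel_homog (a (+) b) (d 0 u).
  by move=> _; rewrite d0; apply: envel_homog0.
have [D0 Dg] := sderP (dr 0) h0; apply: superder_ext D0 _ _.
  by move=> b f g _; rewrite /= mul0r mulr0 scaler0 addr0.
by move=> u; rewrite Dg d0.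
Qed.

Lemma famder_superder a x : homog a x -> superder a (famder x).
Proof.
move=> hx; rewrite famderE.
case: a hx => hx; rewrite !(hpart_homog _ hx) /= sder0 ?(addr0, add0r) -hx.
  exact: (sderaP true x).1.
exact: (sderaP false x).1.
Qed.

Lemma famder_op_homog a x : homog a x -> op_homog a (famder x).
Proof.
move=> hx; apply: superder_homog (famder_superder hx) _ => b u hu.
by rewrite famder_gen; apply: dh.
Qed.

Lemma famder_linear : linear famder.
Proof.
move=> c x y; rewrite -[x in LHS]hpartD -[y in LHS]hpartD.
have hom a x' y' : homog a x' -> homog a y' ->
    famder (c *: x' + y') = c *: famder x' + famder y'.
  move=> hx hy; apply: superder_ext (famder_superder (homog_linear c hx hy)) _ _.
    by apply: superder_lin; apply: famder_superder.
  by move=> u; rewrite linEndD linEndZ !famder_gen dl.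
have split z : famder z = famder (hpart false z) + famder (hpart true z).
  by rewrite !famderE !hpartK /= !sder0 addr0 add0r.
rewrite !hpartD (split (_ + _)) (split x) (split y) ![hpart _ (_ + _)]linearP /=.
rewrite !(hom _ _ _ (homog_hpart _ _) (homog_hpart _ _)).
by rewrite scalerDr addrACA.
Qed.

End FamDer.

Section Representations.
Variables (F : fieldType) (L : lieSuperType F).

Definition is_srep (V : superType F) (act : L -> V -> V) : Prop :=
  [/\ forall v, linear (act^~ v), forall x, linear (act x),
      forall a b x v, homog a x -> homog b v -> homog (a (+) b) (act x v)
    & forall a b x y v, homog a x -> homog b y ->
      act (sbracket x y) v =
        act x (act y v) - (-1) ^+ (a && b) *: act y (act x v)].

Section Contragredient.
Variables (V : superVectType F) (act : L -> V -> V).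

(* [(x . phi) v = - (-1)^(|x||phi|) phi (x . v)] for homogeneous [x], [phi]. *)
Definition dual_act (x : L) (phi : sdual V) : sdual V :=
  - \sum_(a : bool) \sum_(b : bool) (-1) ^+ (a && b) *:
      (hpart b phi \o linfun (act (hpart a x)))%VF.

Hypothesis act_rep : is_srep act.

Let dual_act_val x (phi : sdual V) v : dual_act x phi v =
  - \sum_(a : bool) \sum_(b : bool)
      (-1) ^+ (a && b) * phi (hpart b (act (hpart a x) v)).
Proof.
have [_ actr _ _] := act_rep.
pose act' y : {linear V -> V} := HB.pack (act y)
  (GRing.isLinear.Build F V V *:%R (act y) (actr y)).
rewrite /dual_act opp_lfunE; congr (- _); rewrite sum_lfunE.
apply: eq_bigr => a _; rewrite sum_lfunE; apply: eq_bigr => b _.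
by rewrite scale_lfunE comp_lfunE (lfunE (act' _)) [LHS]/= dual_hpartE.
Qed.

Let act0 v : act 0 v = 0.
Proof.
have [actl _ _ _] := act_rep.
by have := actl v (-1) 0 0; rewrite /= !scaleN1r oppr0 addr0 addNr.
Qed.

Let dual_homogE b (phi : sdual V) v : homog b phi -> phi (hpart b v) = phi v.
Proof. by move=> hphi; rewrite -[in RHS]hphi dual_hpartE. Qed.

Lemma dual_actE a b x (phi : sdual V) v : homog a x -> homog b phi ->
  dual_act x phi v = - (-1) ^+ (a && b) * phi (act x v).
Proof.
move=> hx hphi; rewrite dual_act_val mulNr; congr (- _).
rewrite (bigD1 a) //= (bigD1 b) //= hx (dual_homogE _ hphi).
rewrite !big1 ?addr0 // => [a' na|b' nb].
  rewrite big1 // => b' _.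
  by rewrite (hpart_homog _ hx) (negPf na) act0 !linear0 mulr0.
by rewrite -(dual_homogE _ hphi) hpartK eq_sym (negPf nb) linear0 mulr0.
Qed.

Fact dual_act_linearl phi : linear (dual_act^~ phi).
Proof.
have [actl _ _ _] := act_rep.
move=> c x y; apply/lfunP => v; rewrite add_lfunE scale_lfunE !dual_act_val.
rewrite scalerN -opprD scaler_sumr -big_split; congr (- _).
apply: eq_bigr => a _; rewrite scaler_sumr -big_split; apply: eq_bigr => b _ /=.
by rewrite linearP actl !linearP mulrDr [c *: (_ * _)]mulrCA.
Qed.

Fact dual_act_linearr x : linear (dual_act x).
Proof.
move=> c phi psi; apply/lfunP => v; rewrite add_lfunE scale_lfunE !dual_act_val.
rewrite scalerN -opprD scaler_sumr -big_split; congr (- _).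
apply: eq_bigr => a _; rewrite scaler_sumr -big_split; apply: eq_bigr => b _ /=.
by rewrite add_lfunE scale_lfunE mulrDr [c *: (_ * _)]mulrCA.
Qed.

Let act_hpart a b x v : homog a x -> hpart b (act x v) = act x (hpart (a (+) b) v).
Proof.
have [_ actr acth _] := act_rep => hx.
have actD u w : act x (u + w) = act x u + act x w.
  by have := actr x 1 u w; rewrite /= !scale1r.
have actx0 : act x 0 = 0.
  by have := actr x (-1) 0 0; rewrite /= !scaleN1r oppr0 addr0 addNr.
elim/super_ind: v => [u w IHu IHw|c v hv]; first by
  rewrite actD !linearD /= IHu IHw -actD.
rewrite (hpart_homog _ (acth _ _ _ _ hx hv)) (hpart_homog _ hv).
by case: a b c {hx hv} => [] [] [].
Qed.

Fact dual_act_homog a b x phi :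
  homog a x -> homog b phi -> homog (a (+) b) (dual_act x phi).
Proof.
move=> hx hphi; apply/lfunP => v; rewrite dual_hpartE !(dual_actE _ hx hphi).
by rewrite -(act_hpart b _ hx) (dual_homogE _ hphi).
Qed.

Lemma dual_act_srep : is_srep dual_act.
Proof.
have [_ _ _ actb] := act_rep.
split; [exact: dual_act_linearl|exact: dual_act_linearr|exact: dual_act_homog|].
move=> a b x y phi hx hy.
have DD z (u w : sdual V) : dual_act z (u + w) = dual_act z u + dual_act z w.
  by have := dual_act_linearr z 1 u w; rewrite /= !scale1r.
elim/super_ind: phi => [phi psi IH IH'|c phi hphi].
  by rewrite !DD IH IH' scalerDr opprD addrACA.
apply/lfunP => v; rewrite add_lfunE [X in _ = _ + X]opp_lfunE scale_lfunE.
rewrite (dual_actE _ (sbracket_homog _ _ _ _ hx hy) hphi) (dual_actE _ hx (dual_act_homog hy hphi)).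
rewrite (dual_actE _ hy (dual_act_homog hx hphi)) (dual_actE _ hx hphi) (dual_actE _ hy hphi).
rewrite (actb _ _ _ _ _ hx hy) linearB linearZ /=.
rewrite /GRing.scale /=.
move: (phi _) (phi _) => s t.
by case: a b c {hx hy hphi} => [] [] [] /=; ring.
Qed.

End Contragredient.
End Representations.

Section TensorAction.
Variables (F : fieldType) (m n : nat).

Local Notation g := (gl F m n * gl F m n)%type.

Definition vstd := smx F (@spar m n) epar.
HB.instance Definition _ := SuperVect.on vstd.

Definition vact (x : gl F m n) (v : vstd) : vstd := x *m v.

Lemma vact_srep : is_srep vact.
Proof.
split=> [v c x y|x c v w|a b x v hx hv|a b x y v hx hy].
- by rewrite /vact mulmxDl scalemxAl.
- by rewrite /vact mulmxDr scalemxAr.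
- exact: (homog_mulmx hx hv).
- rewrite /vact [sbracket x y](gl_bracketE hx hy) mulmxBl -scalemxAl.
  by rewrite !mulmxA.
Qed.

(* [V (x) V^*] in the basis [e_i (x) e_j^*]. *)
Definition wtens := smx F (@spar m n) (@spar m n).
HB.instance Definition _ := SuperVect.on wtens.

Definition pure_tens (v : vstd) (phi : sdual vstd) : wtens :=
  \matrix_(i, j) (v i ord0 * phi (delta_mx j ord0 : vstd)).

Lemma homog_pure_tens a b v phi :
  homog a v -> homog b phi -> homog (a (+) b) (pure_tens v phi).
Proof.
move=> /homog_mxP hv hphi; apply/homog_mxP => i j ij; rewrite mxE.
have [ia|ia] := eqVneq (spar i) a; last by rewrite hv ?mul0r // addbF.
have hj : homog (spar j) (delta_mx j ord0 : vstd).
  apply/homog_mxP => k l; rewrite mxE addbF.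
  by case: (k =P j) => // ->; rewrite eqxx.
rewrite -[phi]hphi dual_hpartE (hpart_homog _ hj).
case: eqP => [jb|_]; last by rewrite linear0 mulr0.
by rewrite ia jb eqxx in ij.
Qed.

(* The tensor product of [V] under the first factor with [V^*] under the second,
   that is [x w - (-1)^(|y||w|) w y] for homogeneous [y] and [w]; its defining
   formula on pure tensors is [wact_pure_tens]. *)
Definition wact (x : g) (w : wtens) : wtens :=
  x.1 *m w - \sum_(a : bool) \sum_(b : bool)
    (-1) ^+ (a && b) *: (hpart b w *m hpart a x.2).

Lemma wactE a b x w : homog a x.2 -> homog b w ->
  wact x w = x.1 *m w - (-1) ^+ (a && b) *: (w *m x.2).
Proof.
move=> hx hw; rewrite /wact (bigD1 a) //= (bigD1 b) //= hx hw.
rewrite !big1 ?addr0 // => [a' na|b' nb].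
  rewrite big1 // => b' _.
  by rewrite (hpart_homog _ hx) (negPf na) mulmx0 scaler0.
by rewrite (hpart_homog _ hw) (negPf nb) mul0mx scaler0.
Qed.

Lemma wact_pure_tens a b c (x y : gl F m n) v phi :
  homog a x -> homog a y -> homog b v -> homog c phi ->
  wact (x, y) (pure_tens v phi) =
    pure_tens (vact x v) phi
    + (-1) ^+ (a && b) *: pure_tens v (dual_act vact y phi).
Proof.
move=> hx hy hv hphi.
rewrite (@wactE a (b (+) c) (x, y) _ hy (homog_pure_tens hv hphi)) /=.
apply/matrixP => i j; rewrite !mxE; congr (_ + _).
  by rewrite mulr_suml; apply: eq_bigr => k _; rewrite mxE mulrA.
rewrite (dual_actE vact_srep _ hy hphi).
have -> : vact y (delta_mx j ord0) = \sum_k y k j *: (delta_mx k ord0 : vstd).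
  apply/matrixP => k l; rewrite [LHS]mxE summxE (bigD1 j) //= [RHS](bigD1 k) //=.
  rewrite !mxE ord1 !eqxx !mulr1 !big1 // => k' nk; rewrite !mxE.
    by rewrite eq_sym (negPf nk) mulr0.
  by rewrite (negPf nk) mulr0.
rewrite linear_sum /= !mulr_sumr -sumrN; apply: eq_bigr => k _.
rewrite !mxE linearZ /= /GRing.scale /= sign_andDr; ring.
Qed.

Fact wact_homog a b x w :
  homog a x -> homog b w -> homog (a (+) b) (wact x w).
Proof.
case: x => [x y] /homog_pair[hx hy] hw; rewrite (@wactE a b (x, y) _ hy hw).
rewrite addrC -scaleNr; apply: homog_linear; last exact: (homog_mulmx hx hw).
by rewrite addbC; exact: (homog_mulmx hw hy).
Qed.

Lemma wact_srep : is_srep wact.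
Proof.
split.
- move=> w c x y; rewrite /wact mulmxDl -scalemxAl scalerBr.
  rewrite addrACA -opprD; congr (_ - _).
  rewrite scaler_sumr -big_split; apply: eq_bigr => a _ /=.
  rewrite scaler_sumr -big_split; apply: eq_bigr => b _ /=.
  by rewrite linearP /= mulmxDr -scalemxAr scalerDr !scalerA [c * _]mulrC.
- move=> x c v w; rewrite /wact mulmxDr -scalemxAr scalerBr.
  rewrite addrACA -opprD; congr (_ - _).
  rewrite scaler_sumr -big_split; apply: eq_bigr => a _ /=.
  rewrite scaler_sumr -big_split; apply: eq_bigr => b _ /=.
  by rewrite linearP /= mulmxDl -scalemxAl scalerDr !scalerA [c * _]mulrC.
- exact: wact_homog.
- move=> a b x y w hx hy; elim/super_ind: w => [w w' IH IH'|c w hw].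
    have DD z u u' : wact z (u + u') = wact z u + wact z u'.
      rewrite /wact mulmxDr addrACA -opprD; congr (_ - _).
      rewrite -big_split; apply: eq_bigr => d _ /=.
      rewrite -big_split; apply: eq_bigr => e _ /=.
      by rewrite linearD /= mulmxDl scalerDr.
    rewrite (DD x w w') (DD y w w') (DD _ w w') IH IH'.
    rewrite (DD x (wact y w)) (DD y (wact x w)).
    move: (wact x (wact y w)) (wact x (wact y w')) => u1 u2.
    move: (wact y (wact x w)) (wact y (wact x w')) => u3 u4.
    by rewrite scalerDr opprD addrACA.
  have hxy := sbracket_homog _ _ _ _ hx hy.
  have hxw := wact_homog hx hw; have hyw := wact_homog hy hw.
  case: x y hx hy hxy hxw hyw => [x1 x2] [y1 y2].
  move=> /homog_pair[hx1 hx2] /homog_pair[hy1 hy2] /homog_pair[hxy1 hxy2] hxw hyw.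
  rewrite (@wactE (a (+) b) c (sbracket (x1, x2) (y1, y2)) _ hxy2 hw) (@wactE a (b (+) c) (x1, x2) _ hx2 hyw).
  rewrite (@wactE b (a (+) c) (y1, y2) _ hy2 hxw) (@wactE a c (x1, x2) _ hx2 hw).
  rewrite (@wactE b c (y1, y2) _ hy2 hw) /=.
  rewrite [sbracket x1 y1](gl_bracketE hx1 hy1) [sbracket x2 y2](gl_bracketE hx2 hy2).
  rewrite !(mulmxBr, mulmxBl) -?scalemxAl -?scalemxAr -?scalemxAl !mulmxA.
  apply/matrixP => i j; rewrite !mxE.
  by case: a b c {hx1 hx2 hy1 hy2 hxy1 hxy2 hxw hyw hw} => [] [] [] /=; ring.
Qed.

End TensorAction.
Section Uea.
Variable F : fieldType.

(* [U(L)], the tensor algebra modulo x y - (-1)^(|x||y|) y x = [x, y]. *)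
Definition uea (L : lieSuperType F) := envel (@sbracket F L).
HB.instance Definition _ (L : lieSuperType F) := GRing.Algebra.on (uea L).

Definition ugen (L : lieSuperType F) : L -> uea L := envel_gen (@sbracket F L).
HB.instance Definition _ (L : lieSuperType F) := GRing.Linear.on (@ugen L).

(* [h a] is the component of parity [a] of the superalgebra [A]. *)
Definition supercentralizer (A : algType F) (h : bool -> A -> Prop)
    (S : set A) : set A :=
  [set z | exists z0 z1, [/\ h false z0, h true z1, z = z0 + z1 &
    forall a x, S x -> h a x ->
      z0 * x = x * z0 /\ z1 * x = (-1) ^+ a *: (x * z1)]].

Definition ucenter (L : lieSuperType F) : set (uea L) :=
  supercentralizer (envel_homog (br := @sbracket F L)) setT.

Definition ucenter_filt (L : lieSuperType F) (d : nat) : set (uea L) :=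
  ucenter (L := L) `&` envel_filt (br := @sbracket F L) d.

(* Under U(L x M) = U(L) (x) U(M), [uinl z] is z (x) 1 and [uinr z] is
   1 (x) z. *)
Section Factors.
Variables L M : lieSuperType F.

Definition uinl_gen (x : L) : uea (L * M)%type := ugen (x, 0).
Definition uinr_gen (y : M) : uea (L * M)%type := ugen (0, y).

Fact uinl_gen_linear : linear uinl_gen.
Proof.
move=> c x y; rewrite /uinl_gen -[RHS]linearP; congr ugen; congr pair.
by rewrite /= scaler0 addr0.
Qed.
Fact uinr_gen_linear : linear uinr_gen.
Proof.
move=> c x y; rewrite /uinr_gen -[RHS]linearP; congr ugen; congr pair.
by rewrite /= scaler0 addr0.
Qed.
HB.instance Definition _ := GRing.isLinear.Build F L (uea (L * M)%type) *:%R
  uinl_gen uinl_gen_linear.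
HB.instance Definition _ := GRing.isLinear.Build F M (uea (L * M)%type) *:%R
  uinr_gen uinr_gen_linear.

Fact sbracket00 (N : lieSuperType F) : sbracket (0 : N) 0 = 0.
Proof. by have := sbracketPl (-1) (0 : N) 0 0; rewrite !scaleN1r oppr0 addr0 addNr. Qed.

Fact uinl_br : br_compat (@sbracket F L) uinl_gen.
Proof.
move=> a b x y hx hy.
rewrite [LHS](@envel_rel _ _ (@sbracket F (L * M)%type) a b (x, 0) (y, 0)).
- by congr (_ + ugen (_, _)); rewrite /= sbracket00.
- by apply/homog_pair; split=> //; apply: homog0.
- by apply/homog_pair; split=> //; apply: homog0.
Qed.
Fact uinr_br : br_compat (@sbracket F M) uinr_gen.
Proof.
move=> a b x y hx hy.
rewrite [LHS](@envel_rel _ _ (@sbracket F (L * M)%type) a b (0, x) (0, y)).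
- by congr (_ + ugen (_, _)); rewrite /= sbracket00.
- by apply/homog_pair; split=> //; apply: homog0.
- by apply/homog_pair; split=> //; apply: homog0.
Qed.

Definition uinl : uea L -> uea (L * M)%type := envel_lift uinl_br.
Definition uinr : uea M -> uea (L * M)%type := envel_lift uinr_br.
HB.instance Definition _ := GRing.LRMorphism.on uinl.
HB.instance Definition _ := GRing.LRMorphism.on uinr.

End Factors.
End Uea.

Section DiffOp.
Variables (F : fieldType) (W : superVectType F).

Definition spoly := ssym (sdual W).
HB.instance Definition _ := GRing.Algebra.on spoly.

(* w^* |-> (-1)^|w| <w^*, w>, extended linearly in w. *)
Definition dpairing (w : W) (phi : sdual W) : spoly :=
  (phi (hpart false w) - phi (hpart true w))%:A.

Definition pder (w : W) : linEnd spoly := famder dpairing w.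

Fact dpairing_linearl phi : linear (dpairing^~ phi).
Proof.
move=> c v w; rewrite /dpairing ![hpart _ (_ + _)]linearP ![phi (_ + _)]linearP.
by rewrite opprD addrACA -scalerBr scalerDl [c *: _ in LHS]/= scalerA.
Qed.
Fact dpairing_linearr w : linear (dpairing w).
Proof.
move=> c phi psi; rewrite /dpairing !add_lfunE !scale_lfunE.
by rewrite opprD addrACA -scalerBr scalerDl scalerA.
Qed.
Fact dpairing_homog a b w phi : homog a w -> homog b phi ->
  envel_homog (a (+) b) (dpairing w phi).
Proof.
move=> hw hphi; have [<-|nab] := eqVneq a b.
  by rewrite addbb; apply: envel_homog_cst.
suff -> : dpairing w phi = 0 by apply: envel_homog0.
have phi0 : phi w = 0.
  by rewrite -hphi -hw dual_hpartE hpartK eq_sym (negPf nab) linear0.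
rewrite /dpairing !(hpart_homog _ hw).
by case: (a) => /=; rewrite phi0 linear0 subrr scale0r.
Qed.

Fact pder_linear : linear pder.
Proof. exact: famder_linear dpairing_linearl dpairing_linearr dpairing_homog. Qed.
HB.instance Definition _ := GRing.isLinear.Build F W (linEnd spoly) *:%R
  pder pder_linear.

Lemma pder_gen w phi : pder w (sgen phi) = dpairing w phi.
Proof. exact: famder_gen dpairing_linearl dpairing_linearr dpairing_homog _ _. Qed.

Lemma pder_superder a w : homog a w -> superder a (pder w).
Proof. exact: famder_superder dpairing_linearl dpairing_linearr dpairing_homog _ _. Qed.

Fact pder_br : br_compat (fun _ _ : W => 0) pder.
Proof.
move=> a b v w hv hw; rewrite linear0 addr0; apply/eqP; rewrite -subr_eq0; apply/eqP.
have h c u : homog c u -> op_homog c (pder u).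
  exact: famder_op_homog dpairing_linearl dpairing_linearr dpairing_homog _ _.
have D0 := superder_comm (pder_superder hv) (h _ _ hv) (pder_superder hw) (h _ _ hw).
apply: superder_ext D0 _ _; first by move=> c f g _; rewrite /= mul0r mulr0 scaler0 addr0.
have NE (A B : linEnd spoly) f : (A - B) f = A f - B f by [].
move=> phi; rewrite NE linEndZ !linEndM !pder_gen /dpairing !linearZ /=.
by rewrite (superder1 (pder_superder hv)) (superder1 (pder_superder hw)) oppr0 !scaler0 addr0.
Qed.

Definition partial : ssym W -> linEnd spoly := envel_lift pder_br.
HB.instance Definition _ := GRing.LRMorphism.on partial.

Fact mulop_linear (f : spoly) : linear (fun h : spoly => f * h).
Proof. by move=> c g h; rewrite mulrDr scalerAr. Qed.
Definition mulop (f : spoly) : linEnd spoly := LinEnd (mulop_linear f).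

Definition PDfilt (d : nat) : set (linEnd spoly) :=
  lspan [set D | exists f b, envel_filt (br := fun _ _ : W => 0) d b /\
                             D = mulop f * partial b].

Section Action.
Variables (L : lieSuperType F) (act : L -> W -> W).

Definition pact_gen (x : L) (phi : sdual W) : spoly := sgen (dual_act act x phi).

Definition pact (x : L) : linEnd spoly := famder pact_gen x.

Hypothesis act_rep : is_srep act.

Let cl := let: And4 h _ _ _ := dual_act_srep act_rep in h.
Let cr := let: And4 _ h _ _ := dual_act_srep act_rep in h.
Let ch := let: And4 _ _ h _ := dual_act_srep act_rep in h.
Let cb := let: And4 _ _ _ h := dual_act_srep act_rep in h.

Fact pact_gen_linearl phi : linear (pact_gen^~ phi).
Proof. by move=> c x y; rewrite /pact_gen cl linearP. Qed.
Fact pact_gen_linearr x : linear (pact_gen x).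
Proof. by move=> c phi psi; rewrite /pact_gen cr linearP. Qed.
Fact pact_gen_homog a b x phi : homog a x -> homog b phi ->
  envel_homog (a (+) b) (pact_gen x phi).
Proof. by move=> hx hphi; apply/envel_homog_gen/ch. Qed.

Lemma pact_linear : linear pact.
Proof. exact: famder_linear pact_gen_linearl pact_gen_linearr pact_gen_homog. Qed.

Lemma pactE x phi : pact x (sgen phi) = sgen (dual_act act x phi).
Proof. exact: famder_gen pact_gen_linearl pact_gen_linearr pact_gen_homog _ _. Qed.

Lemma pact_superder a x : homog a x -> superder a (pact x).
Proof. exact: famder_superder pact_gen_linearl pact_gen_linearr pact_gen_homog _ _. Qed.

Lemma pact_br : br_compat (@sbracket F L) pact.
Proof.
move=> a b x y hx hy.
have h c u : homog c u -> op_homog c (pact u).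
  exact: famder_op_homog pact_gen_linearl pact_gen_linearr pact_gen_homog _ _.
have D1 := superder_comm (pact_superder hx) (h _ _ hx) (pact_superder hy) (h _ _ hy).
apply/eqP; rewrite addrC -subr_eq; apply/eqP.
apply: superder_ext D1 (pact_superder (sbracket_homog _ _ _ _ hx hy)) _ => phi.
have NE (A B : linEnd spoly) f : (A - B) f = A f - B f by [].
by rewrite NE linEndZ !linEndM !pactE (cb _ hx hy) [RHS]linearB [X in _ = _ - X]linearZ.
Qed.

Definition PDfilt_inv (d : nat) : set (linEnd spoly) :=
  PDfilt d `&` supercentralizer (@op_homog F (sdual W)) (range pact).

End Action.
End DiffOp.

Section Rho.
Variables (F : fieldType) (m n : nat).

Local Notation g := (gl F m n * gl F m n)%type.

Definition gact : g -> linEnd (spoly (wtens F m n)) := pact (@wact F m n).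
HB.instance Definition _ := GRing.isLinear.Build F g
  (linEnd (spoly (wtens F m n))) *:%R gact (pact_linear (wact_srep F m n)).

Definition rho : uea g -> linEnd (spoly (wtens F m n)) :=
  envel_lift (f := gact) (pact_br (wact_srep F m n)).
HB.instance Definition _ := GRing.LRMorphism.on rho.

Lemma rho_gen x : rho (ugen x) = gact x.
Proof. exact: envel_lift_gen. Qed.

End Rho.

(* Main.v *)
(* Evaluation [ev] at the identity matrix [p] turns an operator [D] on P(W) into
   the functional [f |-> ev (D f)].  Since [x |-> x p] is a bijection from gl(V)
   onto W for either factor, the vector fields of the action at [p] are the
   constant ones up to sign.  Hence:
   - an operator supercommuting with the second factor is determined by its
     functional: commuting vector fields of the second factor past [D] shows that
     all derivatives of [D f] vanish at [p] if the functional is 0;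
   - the functional of an operator of order <= d is that of some u in U^d(gl(V));
   - u in U(gl(V)) is determined by its functional, by means of an Euler formula
     in U(gl(V)) that replaces the PBW theorem.
   So an operator of order <= d supercommuting with the second factor is the image
   of a unique u in U^d(gl(V)), and it supercommutes with the first factor only if
   u is central.  The other case follows by exchanging the factors. *)
From HB Require Import structures.
Require Import Defs.
From mathcomp Require Import all_boot all_order all_algebra.
From mathcomp Require Import boolp classical_sets functions reals.
From mathcomp Require Import ring.
From mathcomp.real_closed Require Import complex.

Set Implicit Arguments.
Unset Strict Implicit.
Unset Printing Implicit Defensive.

Import GRing.Theory.

Local Open Scope ring_scope.
Local Open Scope classical_set_scope.

(** * Spans, filtrations and parity *)

Section Lspan.
Variables (F : fieldType) (A : lmodType F).
Implicit Types (S T : set A) (x y : A).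

Lemma lspan_mem S x : S x -> lspan S x.
Proof.
move=> Sx; exists [:: (1, x)]; split; last by rewrite big_seq1 scale1r.
by move=> p; rewrite inE => /eqP ->.
Qed.

Lemma lspan0 S : lspan S 0.
Proof. by exists [::]; rewrite big_nil. Qed.

Lemma lspanZ S c x : lspan S x -> lspan S (c *: x).
Proof.
case=> s [sS ->]; exists [seq (c * p.1, p.2) | p <- s]; split.
  by move=> _ /mapP[p /sS Sp ->].
by rewrite big_map scaler_sumr; apply: eq_bigr => p _; rewrite scalerA.
Qed.

Lemma lspanD S x y : lspan S x -> lspan S y -> lspan S (x + y).
Proof.
case=> s [sS ->] [t [tS ->]]; exists (s ++ t); split; last by rewrite big_cat.
by move=> p; rewrite mem_cat => /orP[/sS|/tS].
Qed.

Lemma lspanB S x y : lspan S x -> lspan S y -> lspan S (x - y).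
Proof. by move=> Sx Sy; rewrite -scaleN1r; apply/lspanD/lspanZ. Qed.

Lemma lspan_sum S I (r : seq I) (f : I -> A) :
  (forall i, lspan S (f i)) -> lspan S (\sum_(i <- r) f i).
Proof. by move=> Sf; apply: big_ind => //; [apply: lspan0|apply: lspanD]. Qed.

Lemma lspan_ind S (Q : A -> Prop) :
  Q 0 -> (forall c x y, S x -> Q y -> Q (c *: x + y)) ->
  forall x, lspan S x -> Q x.
Proof.
move=> Q0 QD _ [s [sS ->]]; elim: s sS => [|p s IHs] sS; first by rewrite big_nil.
rewrite big_cons; apply: QD; first by apply: sS; rewrite inE eqxx.
by apply: IHs => q qs; apply: sS; rewrite inE qs orbT.
Qed.

Lemma lspan_subset S T : S `<=` lspan T -> lspan S `<=` lspan T.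
Proof.
move=> ST; apply: lspan_ind => [|c x y /ST Tx Ty]; first exact: lspan0.
by apply/lspanD/Ty/lspanZ.
Qed.

End Lspan.

Section EnvelFilt.
Variables (F : fieldType) (L : superType F) (br : L -> L -> L).
Local Notation gen := (envel_gen br).
Local Notation filt := (@envel_filt F L br).
Implicit Types (d e : nat) (z t : envel br).

Lemma envel_filt_prod d (s : seq L) :
  (size s <= d)%N -> filt d (\prod_(x <- s) gen x).
Proof. by move=> sd; apply: lspan_mem; exists s. Qed.

Lemma envel_filtW d e z : (d <= e)%N -> filt d z -> filt e z.
Proof.
move=> de; apply: lspan_subset => _ [s [sd ->]].
exact/envel_filt_prod/(leq_trans sd).
Qed.

Lemma envel_filtM d e z t : filt d z -> filt e t -> filt (d + e) (z * t).
Proof.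
move=> hz ht; elim/lspan_ind: hz => [|c _ y [s [sd ->]] IHy].
  by rewrite mul0r; apply: lspan0.
rewrite mulrDl -scalerAl; apply/lspanD/IHy/lspanZ.
elim/lspan_ind: ht => [|k _ w [r [re ->]] IHw].
  by rewrite mulr0; apply: lspan0.
rewrite mulrDr -scalerAr; apply/lspanD/IHw/lspanZ.
by rewrite -big_cat; apply: envel_filt_prod; rewrite size_cat leq_add.
Qed.

Lemma envel_filt_cst c : filt 0 c%:A.
Proof.
by apply: lspanZ; have := @envel_filt_prod 0 [::] isT; rewrite big_nil.
Qed.

Lemma envel_filt_gen x : filt 1 (gen x).
Proof. by have := @envel_filt_prod 1 [:: x] isT; rewrite big_seq1. Qed.

Lemma envel_filt0P z : filt 0 z -> exists c, z = c%:A.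
Proof.
elim/lspan_ind=> [|c _ y [s [s0 ->]] [k ->]]; first by exists 0; rewrite scale0r.
by case: s s0 => //= _; exists (c + k); rewrite big_nil scalerDl.
Qed.

Lemma envel_filt_exists z : exists d, filt d z.
Proof.
elim/envel_ind: z => [x|c|z t [d hz] [e ht]|z t [d hz] [e ht]].
- by exists 1%N; apply: envel_filt_gen.
- by exists 0%N; apply: envel_filt_cst.
- exists (maxn d e); apply: lspanD.
    exact: envel_filtW (leq_maxl d e) hz.
  exact: envel_filtW (leq_maxr d e) ht.
- by exists (d + e)%N; apply: envel_filtM.
Qed.

End EnvelFilt.

(** * Parity involutions and homogeneous components *)

Section ParityTwist.
Variables (F : fieldType) (V : superType F).
Implicit Types (a b : bool) (v : V).

(** On homogeneous [v] this is multiplication by [(-1)^(a|v|)]. Koszul signs written in this way are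
    linear in [v], so that signed formulas make sense for every [v]. *)
Definition ptw a v : V := hpart false v + (-1) ^+ a *: hpart true v.

Fact ptw_linear a : linear (ptw a).
Proof.
move=> c u v; rewrite /ptw ![hpart _ (_ + _)]linearP /= !scalerDr !scalerA addrACA.
by rewrite [c * _]mulrC.
Qed.
HB.instance Definition _ a := GRing.isLinear.Build F V V *:%R (ptw a) (ptw_linear a).

Lemma ptw_homog a b v : homog b v -> ptw a v = (-1) ^+ (a && b) *: v.
Proof.
move=> hv; rewrite /ptw !(hpart_homog _ hv).
by case: b a {hv} => [] []; rewrite /= ?scaler0 ?addr0 ?add0r ?scale1r.
Qed.

End ParityTwist.

Section EnvelParity.
Variables (F : fieldType) (L : superType F) (br : L -> L -> L).
Hypothesis br_homog : forall a b x y, homog a x -> homog b y ->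
  homog (a (+) b) (br x y).
Local Notation gen := (envel_gen br).
Implicit Types (z t : envel br).

Definition etw_gen a (x : L) : envel br := gen (ptw a x).
Fact etw_gen_linear a : linear (etw_gen a).
Proof. by move=> c x y; rewrite /etw_gen !linearP. Qed.
HB.instance Definition _ a := GRing.isLinear.Build F L (envel br) *:%R
  (etw_gen a) (etw_gen_linear a).

(** Since [br] adds parities, all terms of a defining relation are rescaled by the same sign; hence
    the twist extends to an algebra morphism. *)
Fact etw_br e : br_compat br (etw_gen e).
Proof.
move=> a b x y hx hy; rewrite /= /etw_gen.
rewrite (ptw_homog _ hx) (ptw_homog _ hy) (ptw_homog _ (br_homog hx hy)).
rewrite !linearZ /= -!scalerAl -!scalerAr (envel_rel _ hx hy) !scalerDr !scalerA.
by congr (_ *: _ + _ *: _); rewrite ?sign_andDr; ring.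
Qed.

Definition etw a : envel br -> envel br := envel_lift (etw_br a).
HB.instance Definition _ a := GRing.LRMorphism.on (etw a).

Lemma etw_genE a x : etw a (gen x) = gen (ptw a x).
Proof. exact: envel_lift_gen. Qed.

Lemma etw_homog a b z : envel_homog b z -> etw a z = (-1) ^+ (a && b) *: z.
Proof.
elim=> {b z} [b x hx|c|b|b z t _ IHz _ IHt|b c z t _ IHz _ IHt].
- by rewrite etw_genE (ptw_homog _ hx) linearZ.
- by rewrite [LHS]linearZ /= rmorph1 andbF scale1r.
- by rewrite [LHS]linear0 scaler0.
- by rewrite [LHS]linearD /= IHz IHt scalerDr.
- by rewrite [LHS]rmorphM /= IHz IHt -scalerAl -scalerAr scalerA -sign_andDr.
Qed.

Lemma envel_homogP (z : envel br) : exists z0 z1,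
  [/\ envel_homog false z0, envel_homog true z1, z = z0 + z1 &
      forall a, etw a z = z0 + (-1) ^+ a *: z1].
Proof.
have [z0 [z1 [h0 h1 ->]]] := envel_homog_sum z; exists z0, z1; split=> // a.
by rewrite [LHS]linearD /= (etw_homog a h0) (etw_homog a h1) andbF andbT scale1r.
Qed.

Lemma etw_false z : etw false z = z.
Proof. by have [z0 [z1 [_ _ -> ->]]] := envel_homogP z; rewrite scale1r. Qed.

Lemma etw_filt a d z : envel_filt d z -> envel_filt d (etw a z).
Proof.
elim/lspan_ind=> [|c _ y [s [sd ->]] IHy]; first by rewrite [etw _ _]linear0; apply: lspan0.
rewrite [etw _ _]linearP /=; apply/lspanD/IHy/lspanZ.
rewrite [etw _ _]rmorph_prod (eq_bigr (fun x => gen (ptw a x))) => [|x _]; last exact: etw_genE.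
by rewrite -(big_map (ptw a) xpredT gen); apply: envel_filt_prod; rewrite size_map.
Qed.

Hypothesis F2 : (2 : F) != 0.

(** Parity is generated inductively, so directness of the grading has to be proved: [etw true] fixes
    even elements and negates odd ones, whence [2 z = 0]. *)
Lemma envel_homog_uniq z : envel_homog false z -> envel_homog true z -> z = 0.
Proof.
move=> /(etw_homog true) E /(etw_homog true); rewrite E /= scale1r scaleN1r.
move=> /eqP; rewrite -addr_eq0 -mulr2n -scaler_nat scaler_eq0 (negPf F2).
by move=> /eqP.
Qed.

(** The components are half the sum and half the difference of [z] and [etw true z], and the twist
    preserves the filtration. *)
Lemma envel_filt_homog d z : envel_filt d z -> exists z0 z1,
  [/\ envel_homog false z0, envel_homog true z1, z = z0 + z1,
      envel_filt d z0 & envel_filt d z1].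
Proof.
move=> hz; have [z0 [z1 [h0 h1 Ez Et]]] := envel_homogP z.
have := etw_filt true hz; rewrite Et scaleN1r => hz'.
exists z0, z1; split=> //.
  have -> : z0 = 2^-1 *: (z + (z0 - z1)).
    by rewrite {1}Ez addrACA subrr addr0 -mulr2n -scaler_nat scalerA mulVf ?scale1r.
  exact/lspanZ/lspanD.
have -> : z1 = 2^-1 *: (z - (z0 - z1)).
  by rewrite {1}Ez opprB addrC addrA subrK -mulr2n -scaler_nat scalerA mulVf ?scale1r.
exact/lspanZ/lspanB.
Qed.

End EnvelParity.

(** * Differential operators on P(W) *)

Lemma linEnd_sum (F : fieldType) (A : algType F) I (r : seq I)
    (D : I -> linEnd A) (x : A) : (\sum_(i <- r) D i) x = \sum_(i <- r) D i x.
Proof. by elim/big_rec2: _ => // i y E _ <-. Qed.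

Section SuperDer.
Variables (F : fieldType) (U : superType F).
Implicit Types (f g : ssym U) (D : linEnd (ssym U)).

Fact zero_bracket_homog a b (x y : U) :
  homog a x -> homog b y -> homog (a (+) b) ((fun _ _ => 0) x y : U).
Proof. by move=> _ _; apply: homog0. Qed.

Definition stw : bool -> ssym U -> ssym U := etw zero_bracket_homog.
HB.instance Definition _ a := GRing.LRMorphism.on (stw a).

Lemma stw_homog a b f : envel_homog b f -> stw a f = (-1) ^+ (a && b) *: f.
Proof. exact: etw_homog. Qed.

Lemma stw_gen a u : stw a (sgen u) = sgen (ptw a u).
Proof. exact: etw_genE. Qed.

Lemma ssymP f : exists f0 f1,
  [/\ envel_homog false f0, envel_homog true f1, f = f0 + f1 &
      forall a, stw a f = f0 + (-1) ^+ a *: f1].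
Proof. exact: envel_homogP. Qed.

(** The Leibniz rule for all [f], its sign being carried by the twist. *)
Lemma superderM p D f g : superder p D -> D (f * g) = D f * g + stw p f * D g.
Proof.
move=> Dp; have [f0 [f1 [h0 h1 -> ->]]] := ssymP f.
rewrite mulrDl !linearD /= (Dp _ _ _ h0) (Dp _ _ _ h1) andbF andbT scale1r.
by rewrite !mulrDl scalerAl addrACA.
Qed.

Lemma op_homog_stw p D a f : op_homog p D ->
  stw a (D f) = (-1) ^+ (a && p) *: D (stw a f).
Proof.
move=> Dp; have [f0 [f1 [h0 h1 Ef ->]]] := ssymP f; rewrite [in LHS]Ef.
rewrite linearD [LHS]linearD /= (stw_homog _ (Dp _ _ h0)) (stw_homog _ (Dp _ _ h1)).
by rewrite linearD linearZ /= scalerDr scalerA !sign_andDr andbF andbT mulr1.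
Qed.

End SuperDer.

Section DiffOpTheory.
Variables (F : fieldType) (W : superVectType F).
Local Notation P := (spoly W).
Implicit Types (w v : W) (phi psi : sdual W) (f g h : P) (D : linEnd P).

Lemma mulopE f g : mulop f g = f * g. Proof. by []. Qed.

Lemma homog_sdual a b phi w : homog a phi -> homog b w -> a != b -> phi w = 0.
Proof.
move=> <- hw /negPf ab; rewrite dual_hpartE (hpart_homog _ hw) ab.
exact: linear0.
Qed.

(** Homogeneous vectors with coordinate functionals. Only the expansion of [w] is demanded; the
    [e i] may be linearly dependent, as they arise from projecting the members of an arbitrary basis
    onto both parities. *)
Definition homog_frame (I : finType) (par : I -> bool) (e : I -> W)
    (phi : I -> sdual W) :=
  [/\ forall i, homog (par i) (e i), forall i, homog (par i) (phi i) &
      forall w, w = \sum_i (phi i w : F) *: e i].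

Lemma homog_frame_exists : exists (I : finType) (par : I -> bool) (e : I -> W)
  (phi : I -> sdual W), homog_frame par e phi.
Proof.
pose k := \dim {:W}; pose X := vbasis {:W}.
have lin (a : bool) (i : 'I_k) : linear (fun w : W => coord X i (hpart a w) : F^o).
  by move=> c u v; rewrite !linearP.
pose c a i : {linear W -> F^o} := HB.pack (fun w : W => coord X i (hpart a w) : F^o)
  (GRing.isLinear.Build F W F^o *:%R _ (lin a i)).
exists ('I_k * bool)%type, snd, (fun i : 'I_k * bool => hpart i.2 (X`_i.1 : W)).
exists (fun i : 'I_k * bool => linfun (c i.2 i.1) : sdual W); split=> [i|i|w].
- exact: homog_hpart.
- apply/lfunP => v; rewrite dual_hpartE !lfunE /= hpartK eqxx //.
- have hE a : hpart a w = \sum_(i < k) (c a i w : F) *: hpart a (X`_i : W).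
    have := coord_vbasis (memvf (hpart a w)).
    move=> /(congr1 (hpart a)); rewrite hpartK eqxx linear_sum => ->.
    by apply: eq_bigr => i _; rewrite linearZ.
  rewrite -[LHS]hpartD !hE addrC -(big_bool _ (fun a => \sum_(i < k) _)) exchange_big.
  rewrite (pair_bigA _ (fun i a => (c a i w : F) *: hpart a (X`_i : W))) /=.
  by apply: eq_bigr => i _; rewrite (lfunE (c i.2 i.1)).
Qed.

Lemma sdual_frame (I : finType) (par : I -> bool) (e : I -> W)
    (phi : I -> sdual W) psi :
  homog_frame par e phi -> psi = \sum_i (psi (e i) : F) *: phi i.
Proof.
case=> _ _ frm; apply/lfunP => w; rewrite [in LHS](frm w) linear_sum sum_lfunE.
by apply: eq_bigr => i _; rewrite linearZ scale_lfunE [LHS]mulrC.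
Qed.

Lemma dpairing_homogE a w phi : homog a w ->
  dpairing w phi = ((-1) ^+ a * (phi w : F))%:A.
Proof.
move=> hw; rewrite /dpairing !(hpart_homog _ hw).
by case: a {hw}; rewrite /= linear0 ?subr0 ?sub0r ?mul1r ?mulN1r.
Qed.

Lemma mulop_pder_superder a b h w : envel_homog a h -> homog b w ->
  superder (a (+) b) (mulop h * pder w).
Proof.
move=> hh hw c f g hf; rewrite !linEndM !mulopE (pder_superder hw _ hf) mulrDr.
rewrite mulrA; congr (_ + _); rewrite -scalerAr !mulrA (ssymC hh hf) -!scalerAl.
by rewrite scalerA -sign_andDl addbC.
Qed.

(** A vector field is the sum of its coefficients times the partial derivatives. Both sides are
    superderivations, so linear forms suffice; [(-1) ^+ par i] cancels the sign in the definition of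
    [pder]. *)
Lemma superder_pder (I : finType) (par : I -> bool) (e : I -> W)
    (phi : I -> sdual W) p D :
  homog_frame par e phi -> superder p D -> op_homog p D ->
  D = \sum_i (-1) ^+ par i *: (mulop (D (sgen (phi i))) * pder (e i)).
Proof.
move=> frm Dp Dh; have [he hphi _] := frm.
apply: superder_ext Dp _ _ => [a f g hf|psi].
  rewrite !linEnd_sum mulr_suml mulr_sumr scaler_sumr -big_split; apply: eq_bigr => i _.
  have := mulop_pder_superder (Dh _ _ (envel_homog_gen _ (hphi i))) (he i).
  rewrite -addbA addbb addbF => /(_ a f g hf) E.
  by rewrite !linEndZ E /= scalerDr scalerAl -scalerAr !scalerA mulrC.
rewrite [in LHS](sdual_frame psi frm) !linear_sum linEnd_sum; apply: eq_bigr => i _.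
rewrite linEndZ linEndM mulopE pder_gen (dpairing_homogE _ (he i)).
by rewrite -scalerAr mulr1 scalerA mulrA -signr_addb addbb mul1r !linearZ.
Qed.

Definition pders (ws : seq W) : linEnd P := \prod_(w <- ws) pder w.

Lemma pders_cons w ws : pders (w :: ws) = pder w * pders ws.
Proof. exact: big_cons. Qed.

Lemma partial_prod (ws : seq W) : partial (\prod_(w <- ws) sgen w) = pders ws.
Proof.
rewrite rmorph_prod; apply: eq_bigr => w _; exact: envel_lift_gen.
Qed.

Lemma pder_filt k w f : envel_filt k.+1 f -> envel_filt k (pder w f).
Proof.
have prod a v (s : seq (sdual W)) j : homog a v -> (size s <= j.+1)%N ->
    envel_filt j (pder v (\prod_(x <- s) sgen x)).
  move=> hv; elim: s j => [|phi s IHs] j sj.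
    by rewrite big_nil (superder1 (pder_superder hv)); apply: lspan0.
  rewrite big_cons (superderM _ _ (pder_superder hv)) pder_gen /dpairing.
  apply: lspanD; first by rewrite -scalerAl mul1r; apply/lspanZ/envel_filt_prod.
  case: j sj => [|j] sj.
    case: s sj {IHs} => // _; rewrite big_nil (superder1 (pder_superder hv)) mulr0.
    exact: lspan0.
  by rewrite stw_gen -add1n; apply: envel_filtM (envel_filt_gen _ _) (IHs _ _).
have hom a v : homog a v -> envel_filt k.+1 f -> envel_filt k (pder v f).
  move=> hv; elim/lspan_ind=> [|c _ g [s [sk ->]] IHg].
    by rewrite linear0; apply: lspan0.
  by rewrite linearP /=; apply/lspanD/IHg/lspanZ/(prod a).
by move=> hf; rewrite -[w]hpartD linearD; apply: lspanD; apply: hom hf; apply: homog_hpart.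
Qed.

Definition euler : linEnd P := sder false (@sgen F (sdual W)).

Lemma eulerP : superder false euler /\ forall phi, euler (sgen phi) = sgen phi.
Proof. by apply: sderP => [|a u hu]; [exact: linearP | exact: envel_homog_gen]. Qed.

(** A product of [r] linear forms is an eigenvector of [euler] with eigenvalue [r], so the
    difference removes the terms of degree [k.+1]. *)
Lemma euler_filt k f : envel_filt k.+1 f -> envel_filt k (k.+1%:R *: f - euler f).
Proof.
have [E0 Eg] := eulerP.
have Eprod (s : seq (sdual W)) : euler (\prod_(x <- s) sgen x) =
    (size s)%:R *: \prod_(x <- s) sgen x.
  elim: s => [|phi s IHs]; first by rewrite big_nil (superder1 E0) scale0r.
  rewrite big_cons (superderM _ _ E0) Eg [stw _ _]etw_false IHs -scalerAr.
  by rewrite -{1}[sgen _ * _]scale1r -scalerDl -natr1 addrC.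
elim/lspan_ind=> [|c _ g [s [sk ->]] IHg].
  by rewrite scaler0 linear0 subr0; apply: lspan0.
have -> : euler (c *: \prod_(x <- s) sgen x + g) =
    c *: euler (\prod_(x <- s) sgen x) + euler g by exact: linearP.
rewrite scalerDr opprD addrACA; apply/lspanD/IHg.
rewrite Eprod !scalerA [_ * c]mulrC -!scalerA -scalerBr -scalerBl; apply: lspanZ.
case: (ltngtP (size s) k.+1) sk => // [sk _|-> _]; first exact/lspanZ/envel_filt_prod.
by rewrite subrr scale0r; apply: lspan0.
Qed.

End DiffOpTheory.

(** * Evaluation at an even point *)

Section Evaluation.
Variables (F : fieldType) (W : superVectType F) (p : W).
Hypothesis p_even : homog false p.
Local Notation P := (spoly W).
Implicit Types (f g h : P) (D : linEnd P).

Definition ev_gen (phi : sdual W) : F^o := phi p.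
Fact ev_gen_linear : linear ev_gen.
Proof. by move=> c phi psi; rewrite /ev_gen add_lfunE scale_lfunE. Qed.
HB.instance Definition _ := GRing.isLinear.Build F (sdual W) F^o *:%R
  ev_gen ev_gen_linear.

(** Odd linear forms vanish at an even point, so the values satisfy the supercommutation relations
    in the purely even algebra [F]. *)
Fact ev_br : br_compat (fun _ _ : sdual W => 0) ev_gen.
Proof.
move=> a b phi psi hphi hpsi; rewrite linear0 addr0 /= /ev_gen.
case: a hphi => hphi; last by rewrite scale1r mulrC.
by rewrite (homog_sdual hphi p_even) // mul0r mulr0 scaler0.
Qed.

Definition ev : P -> F^o := envel_lift ev_br.
HB.instance Definition _ := GRing.LRMorphism.on ev.

Lemma ev_genE phi : ev (sgen phi) = phi p.
Proof. exact: envel_lift_gen. Qed.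

Lemma ev_cst c : ev c%:A = c.
Proof. by rewrite linearZ rmorph1 [LHS]mulr1. Qed.

Lemma ev_odd f : envel_homog true f -> ev f = 0.
Proof.
move=> hf; suff: forall a g, envel_homog a g -> a -> ev g = 0 by move/(_ true f hf isT).
move=> a {f hf} g; elim=> {a g} [a phi hphi a1|c //|a _|a f g _ IHf _ IHg a1|].
- by rewrite ev_genE (homog_sdual hphi p_even) // a1.
- by rewrite linear0.
- by rewrite linearD /= IHf // IHg // addr0.
move=> [] [] f g _ IHf _ IHg // _; rewrite rmorphM /=.
  by rewrite IHf ?mul0r.
by rewrite IHg ?mulr0.
Qed.

Lemma ev_stw a f : ev (stw a f) = ev f.
Proof.
have [f0 [f1 [_ h1 -> ->]]] := ssymP f.
by rewrite !linearD linearZ /= (ev_odd h1) scaler0.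
Qed.

(** After evaluation the Koszul sign disappears, because [ev] kills odd polynomials: a
    superderivation becomes an ordinary point derivation. *)
Lemma ev_superder a D f g : superder a D ->
  ev (D (f * g)) = ev (D f) * ev g + ev f * ev (D g).
Proof.
by move=> Da; rewrite (superderM _ _ Da) linearD !rmorphM /= ev_stw.
Qed.

Hypothesis F0 : [pchar F] =i pred0.

(* If all partial derivatives of [f] vanish then so does [euler f], hence
   [deg f * f] has smaller degree than [f]. *)
Lemma ev_pders_eq0 f : (forall ws, ev (pders ws f) = 0) -> f = 0.
Proof.
have [k] := envel_filt_exists f; elim: k f => [|k IHk] f hf f0.
  have [c fE] := envel_filt0P hf.
  by have := f0 [::]; rewrite /pders big_nil fE [LHS]ev_cst => ->; rewrite scale0r.
have df w : pder w f = 0.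
  apply: IHk (pder_filt _ hf) _ => ws; rewrite -(f0 (rcons ws w)) /pders.
  by rewrite -cats1 big_cat big_seq1.
have [I [par [e [phi frm]]]] := homog_frame_exists W.
have [E0 Eg] := eulerP W.
have Eh : op_homog false (@euler F W).
  by apply: superder_homog E0 _ => a u hu; rewrite Eg; apply: envel_homog_gen.
have Ef : euler W f = 0.
  rewrite (superder_pder frm E0 Eh) linEnd_sum big1 // => i _.
  by rewrite linEndZ linEndM df linear0 scaler0.
apply: IHk f0; have := euler_filt hf; rewrite Ef subr0 => /(lspanZ k.+1%:R^-1).
by rewrite scalerA mulVf ?scale1r // (GRing.pcharf0P _).1.
Qed.

End Evaluation.

(** * Vector fields of a representation and constant vector fields *)

Section ActionTheory.
Variables (F : fieldType) (W : superVectType F) (G : lieSuperType F).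
Variable act : G -> W -> W.
Hypothesis act_rep : is_srep act.
Local Notation P := (spoly W).
Local Notation pact := (pact act).
Implicit Types (f g h : P) (w : W) (x : G).

Let actl := let: And4 h _ _ _ := act_rep in h.
Let actr := let: And4 _ h _ _ := act_rep in h.
Let acth := let: And4 _ _ h _ := act_rep in h.

Lemma pact_op_homog a x : homog a x -> op_homog a (pact x).
Proof.
exact: famder_op_homog (pact_gen_linearl act_rep) (pact_gen_linearr act_rep)
  (pact_gen_homog act_rep) _ _.
Qed.

Lemma pactD x y : pact (x + y) = pact x + pact y.
Proof. by have := pact_linear act_rep 1 x y; rewrite !scale1r. Qed.

Lemma pactZ c x : pact (c *: x) = c *: pact x.
Proof.
have p0 : pact 0 = 0.
  by have := pact_linear act_rep (-1) 0 0; rewrite !scaleN1r oppr0 addr0 addNr.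
by have := pact_linear act_rep c x 0; rewrite p0 !addr0.
Qed.

Lemma actDl x y w : act (x + y) w = act x w + act y w.
Proof. by have := actl w 1 x y; rewrite /= !scale1r. Qed.

Lemma actDr x v w : act x (v + w) = act x v + act x w.
Proof. by have := actr x 1 v w; rewrite /= !scale1r. Qed.

(** Both sides are point derivations at [p], so linear forms suffice. There the minus sign is that
    of the contragredient action, and the parity signs agree unless both values are 0. *)
Lemma ev_pact p (p_even : homog false p) x f :
  ev p_even (pact x f) = - ev p_even (pder (act x p) f).
Proof.
elim/super_ind: x => [x y IHx IHy|a x hx].
  rewrite pactD actDl [pder (_ + _)]linearD !linEndD.
  by rewrite [LHS]linearD [ev _ (_ + _)]linearD /= IHx IHy opprD.
have hxp : homog a (act x p) by have := acth hx p_even; rewrite addbF.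
elim/envel_ind: f => [phi|c|f g IHf IHg|f g IHf IHg].
- rewrite -/(sgen _) pactE // pder_gen (dpairing_homogE _ hxp) ev_genE ev_cst.
  elim/super_ind: phi => [phi psi IHphi IHpsi|b phi hphi].
    have -> : dual_act act x (phi + psi) = dual_act act x phi + dual_act act x psi.
      by have := dual_act_linearr act_rep x 1 phi psi; rewrite !scale1r.
    by rewrite !add_lfunE IHphi IHpsi mulrDr opprD.
  rewrite (dual_actE act_rep _ hx hphi) mulNr; congr (- _).
  have [->|ba] := eqVneq b a; first by rewrite andbb.
  by rewrite (homog_sdual hphi hxp ba) !mulr0.
- rewrite [pact x _]linearZ [pder _ _]linearZ /= (superder1 (pder_superder hxp)).
  by rewrite (superder1 (pact_superder act_rep hx)) !scaler0 linear0 oppr0.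
- rewrite [pact x _]linearD [pder _ _]linearD.
  by rewrite [LHS]linearD [ev _ (_ + _)]linearD /= IHf IHg opprD.
- rewrite (ev_superder _ _ _ (pact_superder act_rep hx)).
  by rewrite (ev_superder _ _ _ (pder_superder hxp)) IHf IHg opprD mulNr mulrN.
Qed.

(** The supercommutator of a linear vector field with a constant one is constant; being a
    superderivation, it is determined on linear forms. *)
Lemma pact_pder a x w : homog a x ->
  pact x * pder w = pder (ptw a w) * pact x + pder (act x w).
Proof.
move=> hx; elim/super_ind: w => [v w IHv IHw|b w hw].
  have pderD (v' w' : W) : pder (v' + w') = pder v' + pder w' by exact: linearD.
  have -> : ptw a (v + w) = ptw a v + ptw a w by exact: linearD.
  rewrite actDr (pderD v) (pderD (ptw a v)) (pderD (act x v)) mulrDr mulrDl.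
  by rewrite IHv IHw addrACA.
rewrite (ptw_homog a hw) linearZ /= -scalerAl; apply/eqP.
rewrite addrC -subr_eq; apply/eqP; have hxw := acth hx hw.
have wh : op_homog b (pder w).
  exact: famder_op_homog (@dpairing_linearl F W) (@dpairing_linearr F W)
    (@dpairing_homog F W) _ _ hw.
have D0 := superder_comm (pact_superder act_rep hx) (pact_op_homog hx)
  (pder_superder hw) wh.
apply: superder_ext D0 (pder_superder hxw) _ => phi.
have NE (A B : linEnd P) f : (A - B) f = A f - B f by [].
rewrite NE linEndZ !linEndM pactE // !pder_gen (dpairing_homogE _ hxw).
rewrite !(dpairing_homogE _ hw) linearZ /= (superder1 (pact_superder act_rep hx)).
rewrite scaler0 sub0r scalerA -scaleNr; congr (_ *: _).
elim/super_ind: phi => [phi psi IHphi IHpsi|c phi hphi].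
  have -> : dual_act act x (phi + psi) = dual_act act x phi + dual_act act x psi.
    by have := dual_act_linearr act_rep x 1 phi psi; rewrite !scale1r.
  by rewrite !add_lfunE !mulrDr opprD IHphi IHpsi.
rewrite (dual_actE act_rep _ hx hphi).
have [->|cab] := eqVneq c (a (+) b); last by rewrite (homog_sdual hphi hxw cab) !mulr0 oppr0.
by move: (phi _) => t; case: (a) (b) => [] [] /=; ring.
Qed.

(** Each time the field of [x] is moved to the right past a derivative, it either survives or is
    absorbed into the direction of that derivative. The number of derivatives therefore does not
    grow, and any surviving field still comes from [L]. *)
Lemma pact_pders (L : superType F) (j : {linear L -> G}) :
  (forall a (x : L), homog a x -> homog a (j x)) -> forall (x : L) ws,
  lspan [set D | exists vs B, [/\ size vs = size ws,
      B = 1 \/ exists y : L, B = pact (j y) & D = pders vs * B]]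
    (pact (j x) * pders ws).
Proof.
move=> jh x ws; elim: ws x => [|w ws IHws] x.
  rewrite /pders big_nil mulr1; apply: lspan_mem; exists [::], (pact (j x)).
  by rewrite /pders big_nil mul1r; split=> //; right; exists x.
elim/super_ind: x => [x y IHx IHy|a x hx].
  by rewrite linearD pactD mulrDl; apply: lspanD.
rewrite pders_cons mulrA (pact_pder _ (jh _ _ hx)) mulrDl -!mulrA.
apply: lspanD; last first.
  apply: lspan_mem; exists (act (j x) w :: ws), 1.
  by rewrite pders_cons mulr1; split=> //; left.
have := IHws x; elim/lspan_ind=> [|c _ D [vs [B [vsE hB ->]]] IHD].
  by rewrite mulr0; apply: lspan0.
rewrite mulrDr -scalerAr mulrA -pders_cons; apply/lspanD/IHD/lspanZ/lspan_mem.
by exists (ptw a w :: vs), B; rewrite /= vsE.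
Qed.

End ActionTheory.

(** * Contraction of U(L) with polynomials *)

Section EnvelInd.
Variables (F : fieldType) (L : superType F) (br : L -> L -> L).
Local Notation gen := (envel_gen br).

(** Induction that appends homogeneous generators on the right while tracking the filtration degree,
    the form in which [contr] is recursive. *)
Lemma envel_filt_indr (Q : nat -> envel br -> Prop) :
  (forall k c z t, Q k z -> Q k t -> Q k (c *: z + t)) ->
  (forall k, Q k 1) ->
  (forall k a x z, homog a x -> envel_filt k z -> Q k z -> Q k.+1 (z * gen x)) ->
  forall k z, envel_filt k z -> Q k z.
Proof.
move=> Qlin Q1 QM.
have Q0 k : Q k 0 by have := Qlin k (-1) 1 1 (Q1 k) (Q1 k); rewrite scaleN1r addNr.
move=> k z; elim/lspan_ind=> [|c _ t [s [sk ->]] IHt]; first exact: Q0.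
apply: (Qlin) IHt => {c t z}; elim/last_ind: s k sk => [|s x IHs] k sk.
  by rewrite big_nil.
rewrite size_rcons in sk; case: k sk => // k sk.
rewrite -cats1 big_cat big_seq1 /= -[x]hpartD linearD mulrDr -[X in X + _]scale1r.
have QMx a : Q k.+1 (\prod_(i <- s) gen i * gen (hpart a x)).
  by apply: (QM) (homog_hpart a x) _ _; [apply: envel_filt_prod|apply: IHs].
exact: (Qlin) _ _ _ _ (QMx false) (QMx true).
Qed.

End EnvelInd.

Section AntiLift.
Variables (F : fieldType) (L : superType F) (br : L -> L -> L) (E : algType F).
Variable f : {linear L -> E}.
Hypothesis f_br : forall a b x y, homog a x -> homog b y ->
  f y * f x = (-1) ^+ (a && b) *: (f x * f y) + f (br x y).

Fact rmulop_linear (e : E) : linear (fun x : E => x * e).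
Proof. by move=> c x y; rewrite mulrDl scalerAl. Qed.
Definition rmulop (e : E) : linEnd E := LinEnd (rmulop_linear e).

Definition antilift_gen (x : L) : linEnd E := rmulop (f x).
Fact antilift_gen_linear : linear antilift_gen.
Proof.
by move=> c x y; apply: linEnd_ext => e; rewrite /= linearP mulrDr scalerAr.
Qed.
HB.instance Definition _ := GRing.isLinear.Build F L (linEnd E) *:%R
  antilift_gen antilift_gen_linear.

Fact antilift_br : br_compat br antilift_gen.
Proof.
move=> a b x y hx hy; apply: linEnd_ext => e /=.
by rewrite -!mulrA (f_br hx hy) mulrDr -scalerAr.
Qed.

(* An algebra morphism to the opposite of [E], read off right multiplications. *)
Definition antilift (z : envel br) : E := envel_lift antilift_br z 1.

Lemma antilift_linear : linear antilift.
Proof. by move=> c z t; rewrite /antilift [envel_lift _ _]linearP. Qed.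

Lemma antilift1 : antilift 1 = 1.
Proof. by rewrite /antilift rmorph1. Qed.

Lemma antiliftM z x : antilift (z * envel_gen br x) = f x * antilift z.
Proof.
(* The lift acts by right multiplications, which commute with left ones. *)
have comm e1 e2 : envel_lift antilift_br z (e1 * e2) =
    e1 * envel_lift antilift_br z e2.
  elim/envel_ind: z e1 e2 => [y|c|z t IHz IHt|z t IHz IHt] e1 e2.
  - by rewrite envel_lift_gen /= mulrA.
  - by rewrite linearZ /= rmorph1 /= scalerAr.
  - by rewrite linearD /= IHz IHt mulrDr.
  - by rewrite rmorphM /= IHt IHz.
rewrite /antilift rmorphM /= envel_lift_gen /= mul1r.
by rewrite -[f x in LHS]mulr1 comm.
Qed.

End AntiLift.

(* For [A = End(P + U)] with [l] acting on P from the left, [r] on U from the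
   right and [k] the parity of P, [ract] restricts to the right action
   [c |-> c l_x + r_x c k^|x|] of the Lie superalgebra on Hom(P, U). *)
Section RightAction.
Variables (F : fieldType) (L : superType F) (br : L -> L -> L) (A : algType F).
Variables (l r : {linear L -> A}) (k : A).
Hypothesis br_homog : forall a b x y, homog a x -> homog b y ->
  homog (a (+) b) (br x y).
Hypothesis kk : k * k = 1.
Hypothesis kl : forall a x, homog a x -> k * l x = (-1) ^+ a *: (l x * k).
Hypothesis l_br : br_compat br l.
Hypothesis r_br : forall a b x y, homog a x -> homog b y ->
  r y * r x = (-1) ^+ (a && b) *: (r x * r y) + r (br x y).

Definition ract_fun (x : L) (c : A) : A :=
  c * l x + (r (hpart false x) * c + r (hpart true x) * c * k).

Fact ract_fun_linear x : linear (ract_fun x).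
Proof.
move=> a c d; rewrite /ract_fun !(mulrDl, mulrDr) -!scalerAl -!scalerAr -!scalerAl.
rewrite [in RHS]scalerDr [in RHS]addrACA; congr (_ + _).
by rewrite scalerDr addrACA.
Qed.
Definition ract x : linEnd A := LinEnd (ract_fun_linear x).

Fact ract_linear : linear ract.
Proof.
move=> a x y; apply: linEnd_ext => c.
have -> : (a *: ract x + ract y) c = a *: ract_fun x c + ract_fun y c by [].
rewrite /= /ract_fun ![hpart _ (a *: x + y)]linearP ![l (a *: x + y)]linearP /=.
rewrite ![r (_ *: _ + _)]linearP !(mulrDl, mulrDr) -?scalerAl -?scalerAr -?scalerAl.
rewrite [in RHS]scalerDr [in RHS]addrACA; congr (_ + _).
by rewrite scalerDr addrACA.
Qed.
HB.instance Definition _ := GRing.isLinear.Build F L (linEnd A) *:%R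
  ract ract_linear.

Lemma ractE a x c : homog a x -> ract x c = c * l x + r x * c * k ^+ a.
Proof.
move=> hx; rewrite /= /ract_fun !(hpart_homog _ hx).
by case: a {hx}; rewrite /= linear0 !mul0r ?add0r ?addr0 ?expr1 ?expr0 ?mulr1.
Qed.

(** The mixed terms in [l] and [r] agree once [k] is moved past [l]; the pure terms are the
    relations for [l] and [r]. The reversed order of the factors calls for [antilift]. *)
Lemma ract_br a b x y : homog a x -> homog b y ->
  ract y * ract x = (-1) ^+ (a && b) *: (ract x * ract y) + ract (br x y).
Proof.
move=> hx hy; apply: linEnd_ext => c.
rewrite linEndD linEndZ !linEndM (ractE _ hx) (ractE c hy) (ractE _ hy) (ractE _ hx).
rewrite (ractE _ (br_homog hx hy)).
have klE d z (e : bool) : homog d z -> k ^+ e * l z = (-1) ^+ (e && d) *: (l z * k ^+ e).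
  by move=> hz; case: e; rewrite ?mulr1 ?mul1r ?scale1r // (kl hz).
have kE : k ^+ a * k ^+ b = k ^+ (a (+) b).
  by case: a b {hx hy} => [] []; rewrite /= ?mulr1 ?mul1r ?kk.
have kE' : k ^+ b * k ^+ a = k ^+ (a (+) b).
  by rewrite addbC; case: a b {hx hy kE} => [] []; rewrite /= ?mulr1 ?mul1r ?kk.
rewrite !(mulrDl, mulrDr) -!mulrA kE kE' (klE _ _ a hy) (klE _ _ b hx).
rewrite (l_br hx hy) [r y * (r x * _)]mulrA (r_br hx hy).
rewrite !(mulrDl, mulrDr, scalerDr) -?scalerAl -?scalerAr -?scalerAl !scalerA.
rewrite [b && a]andbC -signr_addb addbb scale1r -!mulrA !addrA.
by rewrite [LHS](ACl (1*4*3*5*2*6)).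
Qed.

End RightAction.

Section Contraction.
Variables (F : fieldType) (W : superVectType F) (G L : lieSuperType F).
Variables (act : G -> W -> W) (j : {linear L -> G}).
Hypothesis act_rep : is_srep act.
Hypothesis j_homog : forall a (x : L), homog a x -> homog a (j x).
Variable J : {lrmorphism uea L -> linEnd (spoly W)}.
Hypothesis J_gen : forall x : L, J (ugen x) = pact act (j x).
Variables (p : W) (p_even : homog false p).
Local Notation P := (spoly W).
Local Notation U := (uea L).
Local Notation A := (linEnd (P * U)%type).
Local Notation ev := (ev p_even).

Fact lact_fun_linear (x : L) :
  linear (fun v : P * U => (pact act (j x) v.1, 0) : P * U).
Proof. by move=> c [f u] [g v]; congr pair; rewrite /= ?linearP ?scaler0 ?addr0. Qed.
Definition lact x : A := LinEnd (lact_fun_linear x).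
Fact lact_linear : linear lact.
Proof.
move=> c x y; apply: linEnd_ext => -[f u]; congr pair => /=; last first.
  by rewrite scaler0 addr0.
by rewrite linearD linearZ /= pactD // pactZ.
Qed.
HB.instance Definition _ := GRing.isLinear.Build F L A *:%R lact lact_linear.

Fact rmul_fun_linear (x : L) :
  linear (fun v : P * U => (0, v.2 * ugen x) : P * U).
Proof.
move=> c [f u] [g v]; congr pair; rewrite /= ?scaler0 ?addr0 //.
by rewrite mulrDl scalerAl.
Qed.
Definition rmul x : A := LinEnd (rmul_fun_linear x).
Fact rmul_linear : linear rmul.
Proof.
move=> c x y; apply: linEnd_ext => -[f u]; congr pair => /=.
  by rewrite scaler0 addr0.
by rewrite linearP mulrDr scalerAr.
Qed.
HB.instance Definition _ := GRing.isLinear.Build F L A *:%R rmul rmul_linear.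

Fact ktw_linear : linear (fun v : P * U => (stw true v.1, v.2) : P * U).
Proof. by move=> c [f u] [g v]; congr pair; rewrite /= linearP. Qed.
Definition ktw : A := LinEnd ktw_linear.

Fact evl_linear : linear (fun v : P * U => (0, (ev v.1 : F)%:A) : P * U).
Proof.
move=> c [f u] [g v]; congr pair; rewrite /= ?scaler0 ?addr0 //.
by rewrite linearP scalerDl scalerA.
Qed.
(** The map [f |-> (ev f) 1] from P to U, on which the right action generates [contr]. *)
Definition evl : A := LinEnd evl_linear.

Fact ktwK : ktw * ktw = 1.
Proof.
apply: linEnd_ext => -[f u]; congr pair => /=.
have [f0 [f1 [h0 h1 Ef ->]]] := ssymP f.
rewrite linearD linearZ /= (stw_homog _ h0) (stw_homog _ h1) Ef.
by rewrite /= scale1r !scaleN1r opprK.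
Qed.

Fact ktw_lact a x : homog a x -> ktw * lact x = (-1) ^+ a *: (lact x * ktw).
Proof.
move=> hx; apply: linEnd_ext => -[f u]; congr pair => /=; last by rewrite scaler0.
by rewrite (op_homog_stw _ _ (pact_op_homog act_rep (j_homog hx))).
Qed.

Lemma pact_lift_br : br_compat (@sbracket F L) (fun x => pact act (j x)).
Proof.
move=> a b x y hx hy; rewrite -!J_gen -!rmorphM -linearZ -linearD.
by congr (J _); exact: envel_rel.
Qed.

Fact lact_br : br_compat (@sbracket F L) lact.
Proof.
move=> a b x y hx hy; apply: linEnd_ext => -[f u]; congr pair => /=; last first.
  by rewrite scaler0 addr0.
by have /(congr1 (fun D : linEnd P => D f)) := pact_lift_br hx hy.
Qed.

Fact rmul_br a b x y : homog a x -> homog b y ->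
  rmul y * rmul x = (-1) ^+ (a && b) *: (rmul x * rmul y) + rmul (sbracket x y).
Proof.
move=> hx hy; apply: linEnd_ext => -[f u]; congr pair => /=.
  by rewrite scaler0 addr0.
by rewrite -!mulrA (envel_rel _ hx hy) mulrDr -scalerAr.
Qed.

Definition coprod_ev : U -> linEnd A :=
  antilift (ract_br (@sbracket_homog F L) ktwK ktw_lact lact_br rmul_br).

(* With the coproduct of U written u_1 (x) u_2, this is the sum of the
   [+- ev (u_1 f) u_2]. *)
Definition contr (u : U) (f : P) : U := (coprod_ev u evl (f, 0)).2.

Lemma contr_linearl f : linear (contr^~ f).
Proof.
move=> c u v; rewrite /contr /coprod_ev.
by rewrite (antilift_linear (ract_br _ _ _ _ _) c u v).
Qed.

Lemma contr_linearr u : linear (contr u).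
Proof.
move=> c f g; rewrite /contr.
have -> : (c *: f + g, 0) = c *: (f, 0) + (g, 0) :> P * U.
  by congr pair; rewrite /= scaler0 addr0.
by rewrite linearP.
Qed.

Lemma contr_one f : contr 1 f = (ev f : F)%:A.
Proof. by rewrite /contr /coprod_ev antilift1. Qed.

(** Generators are primitive for the coproduct: [x] either acts on [f] or is kept as a right factor,
    with the sign of passing [f]. *)
Lemma contr_mulgen a u x f : homog a x -> contr (u * ugen x) f =
  contr u (pact act (j x) f) + contr u (stw a f) * ugen x.
Proof.
move=> hx; rewrite /contr /coprod_ev antiliftM linEndM.
set C := linEnd_fun (antilift _ u) evl; rewrite (ractE _ _ ktw C hx).
have -> : (C * lact x + rmul x * C * ktw ^+ a) (f, 0) =
  C (pact act (j x) f, 0) + rmul x (C ((ktw ^+ a) (f, 0))) by [].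
congr (_ + _ * _); congr (C _).2; case: a {hx} => //=.
by rewrite [stw _ _]etw_false.
Qed.

Lemma J_mulgen u x f : J (u * ugen x) f = J u (pact act (j x) f).
Proof.
rewrite -J_gen; have -> : J (u * ugen x) = J u * J (ugen x); last by [].
exact: rmorphM.
Qed.

Lemma J_linearE c u v f : J (c *: u + v) f = c *: J u f + J v f.
Proof. by have -> : J (c *: u + v) = c *: J u + J v by exact: linearP. Qed.

Lemma J_cst c f : J c%:A f = c *: f.
Proof. by have -> : J c%:A = c%:A by rewrite [LHS]linearZ /= rmorph1. Qed.

(** Contraction by [f] is the transpose of multiplication by [f] on the functionals
    [h |-> ev (J u h)]. The recursion for [contr] matches the Leibniz rule for [f * h]. *)
Lemma ev_contr u f h : ev (J u (f * h)) = ev (J (contr u f) h).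
Proof.
have [k hu] := envel_filt_exists u.
elim/envel_filt_indr: hu f h => {k u} [_ c u v IHu IHv|_|_ a x u hx _ IHu] f h.
- have -> : contr (c *: u + v) f = c *: contr u f + contr v f by exact: contr_linearl.
  have evE (g g' : P) : ev (c *: g + g') = c *: ev g + ev g' by exact: linearP.
  by rewrite !J_linearE !evE IHu IHv.
- by rewrite contr_one J_cst rmorph1 [RHS]linearZ [LHS]rmorphM.
- rewrite (contr_mulgen _ _ hx) -[contr u _]scale1r J_linearE scale1r !J_mulgen.
  rewrite (superderM _ _ (pact_superder act_rep (j_homog hx))).
  by rewrite linearD [LHS]linearD [RHS]linearD /= IHu IHu.
Qed.

Lemma contrD u f g : contr u (f + g) = contr u f + contr u g.
Proof. by have := contr_linearr u 1 f g; rewrite !scale1r. Qed.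

Lemma contrZ u c f : contr u (c *: f) = c *: contr u f.
Proof.
have c0 : contr u 0 = 0.
  by have := contr_linearr u (-1) 0 0; rewrite !scaleN1r oppr0 addr0 addNr.
by have := contr_linearr u c f 0; rewrite c0 !addr0.
Qed.

Lemma contr_1r u : contr u 1 = u.
Proof.
have [k] := envel_filt_exists u.
elim/envel_filt_indr=> {k u} [_ c u v IHu IHv|_|_ a x u hx _ IHu].
- by rewrite contr_linearl IHu IHv.
- by rewrite contr_one rmorph1 scale1r.
- rewrite (contr_mulgen _ _ hx) (superder1 (pact_superder act_rep (j_homog hx))).
  by rewrite -(scale0r 1) contrZ scale0r add0r rmorph1 IHu.
Qed.

Lemma contr_filt k u f : envel_filt k u -> envel_filt k (contr u f).
Proof.
move=> hu; elim/envel_filt_indr: hu f => {k u} [k c u v IHu IHv|k|k a x u hx _ IHu] f.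
- by rewrite contr_linearl; apply/lspanD/IHv/lspanZ/IHu.
- by rewrite contr_one; apply: envel_filtW (envel_filt_cst _ _).
- rewrite (contr_mulgen _ _ hx) -addn1; apply: lspanD.
    by apply: envel_filtW (IHu _); rewrite leq_addr.
  exact: envel_filtM (IHu _) (envel_filt_gen _ _).
Qed.

(* [U^{k-1}], with [U^{-1} = 0]. *)
Definition filt_pred k (u : U) : Prop := if k is k'.+1 then envel_filt k' u else u = 0.

Lemma filt_predP k c u v : filt_pred k u -> filt_pred k v -> filt_pred k (c *: u + v).
Proof.
case: k => [->->|k hu hv]; first by rewrite scaler0 addr0.
by apply/lspanD/hv/lspanZ.
Qed.

Lemma filt_predM k u x : filt_pred k u -> envel_filt k (u * ugen x).
Proof.
case: k => [->|k hu]; first by rewrite mul0r; apply: lspan0.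
by rewrite -addn1; apply: envel_filtM hu (envel_filt_gen _ _).
Qed.

(** Contraction by a polynomial vanishing at [p] costs one degree: either the last generator is
    spent on [f], or it is kept and the twisted [f], which still vanishes at [p], lowers the degree
    of the remaining factor. *)
Lemma contr_filt_pred k u f : envel_filt k u -> ev f = 0 -> filt_pred k (contr u f).
Proof.
move=> hu; elim/envel_filt_indr: hu f => {k u} [k c u v IHu IHv|k|k a x u hx hu IHu] f f0.
- by rewrite contr_linearl; apply: filt_predP; [apply: IHu|apply: IHv].
- by rewrite contr_one f0 scale0r; case: k => // k; apply: lspan0.
- rewrite (contr_mulgen _ _ hx) /=; apply: lspanD; first exact: contr_filt.
  by apply/filt_predM/IHu; rewrite ev_stw.
Qed.

(** * The Euler formula in U(L) and injectivity on functionals *)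

Variable psi : {linear W -> L}.
Hypothesis psi_homog : forall a w, homog a w -> homog a (psi w).
Hypothesis psiK : forall x : L, psi (act (j x) p) = x.
Variables (I : finType) (par : I -> bool) (e : I -> W) (phi : I -> sdual W).
Hypothesis frm : homog_frame par e phi.

(* Affine coordinates vanishing at [p]. *)
Definition pt_coord i : P := sgen (phi i) - (phi i p : F)%:A.
(** Dual to [pt_coord] in the sense of [dual_gen_sum]; the signs cancel those of [ev_pact] and
    [dpairing]. *)
Definition dual_gen i : L := - ((-1) ^+ par i *: psi (e i)).
(** By [ev_contr], its functional is that of [u] applied after the sum of the [pt_coord i] times the
    fields of [dual_gen i], an analogue of the Euler field centred at [p]. *)
Definition uea_euler (u : U) : U := \sum_i contr u (pt_coord i) * ugen (dual_gen i).

Lemma ev_pt_coord i : ev (pt_coord i) = 0.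
Proof. by rewrite linearB /= ev_genE ev_cst subrr. Qed.

Lemma pt_coord_homog i : envel_homog (par i) (pt_coord i).
Proof.
have [_ hphi _] := frm.
apply: envel_homogD; first exact: envel_homog_gen.
case E: (par i); last by rewrite -scaleNr; apply: envel_homog_cst.
have hi := hphi i; rewrite E in hi.
by rewrite (homog_sdual hi p_even) // scale0r oppr0; apply: envel_homog0.
Qed.

Lemma dual_gen_homog i : homog (par i) (dual_gen i).
Proof.
have [he _ _] := frm; rewrite /dual_gen -scaleNr -[_ *: _]addr0.
by apply: homog_linear (homog0 _ _); apply: psi_homog.
Qed.

(** By [ev_pact] the coefficients are, up to sign, the coordinates of [act (j x) p] in the frame, so
    the sum is [psi (act (j x) p)]. *)
Lemma dual_gen_sum a x : homog a x ->
  \sum_i (ev (pact act (j x) (pt_coord i)) : F) *: dual_gen i = x.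
Proof.
move=> hx; have [he hphi hw] := frm.
have hxp : homog a (act (j x) p).
  by have [_ _ acth _] := act_rep; have := acth _ _ _ _ (j_homog hx) p_even; rewrite addbF.
rewrite -[RHS]psiK (hw (act (j x) p)) linear_sum; apply: eq_bigr => i _.
have -> : pact act (j x) (pt_coord i) = pact act (j x) (sgen (phi i)).
  rewrite linearB /= [X in _ - X]linearZ /=.
  by rewrite (superder1 (pact_superder act_rep (j_homog hx))) scaler0 subr0.
rewrite (ev_pact act_rep) pder_gen (dpairing_homogE _ hxp) ev_cst [RHS]linearZ.
rewrite /dual_gen scalerN scaleNr opprK scalerA mulrAC.
have [->|pa] := eqVneq (par i) a; first by rewrite -signr_addb addbb mul1r.
by rewrite (homog_sdual (hphi i) hxp pa) mulr0 /= !scale0r.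
Qed.

Lemma uea_euler_linear : linear uea_euler.
Proof.
move=> c u v; rewrite /uea_euler scaler_sumr -big_split; apply: eq_bigr => i _ /=.
by rewrite contr_linearl mulrDl scalerAl.
Qed.

(** [uea_euler] acts by [k] on [U^k / U^(k-1)]. Appending a generator [x] to [u] contributes one
    further [u * ugen x], by [dual_gen_sum], and otherwise only terms of lower degree. *)
Lemma uea_euler_filt k u :
  envel_filt k u -> filt_pred k (uea_euler u - k%:R *: u).
Proof.
elim/envel_filt_indr=> {k u} [k c u v IHu IHv|k|k a x u hx hu IHu].
- rewrite uea_euler_linear scalerDr opprD addrACA.
  rewrite scalerA mulrC -scalerA -scalerBr; exact: filt_predP.
- have -> : uea_euler 1 = 0.
    by rewrite /uea_euler big1 // => i _; rewrite contr_one ev_pt_coord scale0r mul0r.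
  case: k => [|k]; first by rewrite /= scale0r subr0.
  rewrite /filt_pred sub0r -scaleNr; apply: lspanZ.
  by have := envel_filtW (leq0n k) (envel_filt_cst (@sbracket F L) 1); rewrite scale1r; apply.
- pose y i := contr u (pt_coord i).
  have hy i : filt_pred k (y i) by apply: contr_filt_pred (ev_pt_coord i).
  (* The field of [x] sends [pt_coord i] to its value at [p] plus a remainder vanishing there;
     moving [dual_gen i] to the left of [x] leaves a bracket. The remainder and the bracket give the
     lower terms. *)
  have yE i : contr (u * ugen x) (pt_coord i) * ugen (dual_gen i) =
      (ev (pact act (j x) (pt_coord i)) : F) *: (u * ugen (dual_gen i))
      + y i * ugen (dual_gen i) * ugen x
      + (contr u (pact act (j x) (pt_coord i) - (ev (pact act (j x) (pt_coord i)) : F)%:A)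
            * ugen (dual_gen i)
         + (-1) ^+ (a && par i) *: (y i * ugen (sbracket x (dual_gen i)))).
    set g := pact act (j x) (pt_coord i).
    have -> : contr u (g - (ev g : F)%:A) = contr u g - (ev g : F) *: u.
      by rewrite -scaleNr contrD contrZ contr_1r scaleNr.
    rewrite (contr_mulgen _ _ hx) -/g (stw_homog _ (pt_coord_homog i)) contrZ -/(y i).
    rewrite mulrDl mulrBl -!scalerAl -!mulrA (envel_rel _ hx (dual_gen_homog i)).
    rewrite mulrDr scalerDr -scalerAr scalerA -signr_addb addbb scale1r.
    move: (_ *: (u * _)) (contr u g * _) => X Y.
    by rewrite [RHS]addrACA [X + _]addrC subrK.
  rewrite /uea_euler (eq_bigr _ (fun i _ => yE i)) !big_split /=.
  have -> : \sum_i (ev (pact act (j x) (pt_coord i)) : F) *: (u * ugen (dual_gen i)) =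
      u * ugen x.
    rewrite -[in RHS](dual_gen_sum hx) linear_sum mulr_sumr; apply: eq_bigr => i _.
    by rewrite linearZ scalerAr.
  rewrite -mulr_suml -/(uea_euler u) -natr1 scalerDl scale1r.
  rewrite [X in envel_filt _ X](_ : _ = (uea_euler u - k%:R *: u) * ugen x +
    \sum_i (contr u (pact act (j x) (pt_coord i) - (ev (pact act (j x) (pt_coord i)) : F)%:A)
            * ugen (dual_gen i)
         + (-1) ^+ (a && par i) *: (y i * ugen (sbracket x (dual_gen i))))).
    apply: lspanD; first exact: filt_predM.
    apply: lspan_sum => i; apply: lspanD; last exact/lspanZ/filt_predM.
    by apply/filt_predM/contr_filt_pred => //; rewrite linearB /= ev_cst subrr.
  rewrite big_split mulrBl -scalerAl opprD [LHS]addrAC; congr (_ + _).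
  by rewrite [- _ - _]addrC addrACA subrr add0r.
Qed.

Hypothesis F0 : [pchar F] =i pred0.

(** If the functional of [u] is 0, so are those of its contractions by [pt_coord i], which have
    lower degree and vanish by induction. Then [uea_euler u = 0], and the Euler formula puts [u]
    itself in lower degree. *)
Lemma ev_J_eq0 u : (forall f, ev (J u f) = 0) -> u = 0.
Proof.
have [k] := envel_filt_exists u; elim: k u => [|k IHk] u hu u0.
  have [c uE] := envel_filt0P hu.
  have := u0 1; rewrite uE J_cst linearZ /= rmorph1 [_ *: _]mulr1 => ->.
  exact: scale0r.
have c0 i : contr u (pt_coord i) = 0.
  apply: IHk => [|f]; first exact: (contr_filt_pred hu (ev_pt_coord i)).
  by rewrite -ev_contr.
have := uea_euler_filt hu; rewrite /uea_euler big1 => [|i _]; last by rewrite c0 mul0r.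
rewrite /= sub0r -scaleNr => /(lspanZ (- k.+1%:R)^-1).
rewrite scalerA mulVf ?oppr_eq0 ?(GRing.pcharf0P _).1 // scale1r => hk.
exact: IHk.
Qed.

End Contraction.

(** * Commuting actions that are simply transitive at a point *)

Section Prehomogeneous.
Variables (F : fieldType) (W : superVectType F) (G L M : lieSuperType F).
Hypothesis F0 : [pchar F] =i pred0.
Variable act : G -> W -> W.
Hypothesis act_rep : is_srep act.
Variables (j : {linear L -> G}) (j' : {linear M -> G}).
Hypothesis j_homog : forall a (x : L), homog a x -> homog a (j x).
Hypothesis j'_homog : forall a (y : M), homog a y -> homog a (j' y).
Hypothesis jj' : forall (x : L) (y : M), sbracket (j x) (j' y) = 0.
Hypothesis jD : forall a (g : G), homog a g ->
  exists (x : L) (y : M), [/\ homog a x, homog a y & g = j x + j' y].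
Variable J : {lrmorphism uea L -> linEnd (spoly W)}.
Hypothesis J_gen : forall x : L, J (ugen x) = pact act (j x).
Variables (p : W) (p_even : homog false p).
Variable psi : {linear W -> L}.
Hypothesis psi_homog : forall a w, homog a w -> homog a (psi w).
Hypothesis psiK : forall x : L, psi (act (j x) p) = x.
Hypothesis psiKV : forall w, act (j (psi w)) p = w.
Hypothesis j'_surj : forall w, exists y : M, act (j' y) p = w.
Local Notation P := (spoly W).
Local Notation U := (uea L).
Local Notation pact := (pact act).
Local Notation ev := (ev p_even).
Implicit Types (f g h : P) (D E : linEnd P) (u v z : U).

Lemma pact_comm a b (x y : G) : homog a x -> homog b y -> sbracket x y = 0 ->
  pact x * pact y = (-1) ^+ (a && b) *: (pact y * pact x).
Proof.
move=> hx hy xy; rewrite (pact_br act_rep hx hy) xy -(scale0r 0) pactZ //.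
by rewrite scale0r addr0.
Qed.

(** At [p] the outermost derivative of [D f] is minus a field of the second factor. Moved to the
    right past the other derivatives, that field either is absorbed or reaches [D f] and yields some
    [D g]; either way one derivative fewer remains. *)
Lemma eq0_of_ev D : (forall (y : M) f, exists g, pact (j' y) (D f) = D g) ->
  (forall f, ev (D f) = 0) -> D = 0.
Proof.
move=> stab D0; apply: linEnd_ext => f; rewrite [RHS](_ : _ = 0) //.
apply: (@ev_pders_eq0 _ _ _ p_even F0) => ws; have [k kE] := ubnP (size ws).
elim: k ws kE f => // k IHk [|w ws] /= kE f; first by rewrite /pders big_nil D0.
rewrite pders_cons linEndM; have [y <-] := j'_surj w.
apply/eqP; rewrite -oppr_eq0 -(ev_pact act_rep p_even) -linEndM; apply/eqP.
elim/lspan_ind: (pact_pders act_rep j'_homog y ws) => [|c _ A [vs [B [vsE hB ->]]] IHA].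
  by rewrite linear0.
have -> : ev ((c *: (pders vs * B) + A) (D f)) =
    c *: ev (pders vs (B (D f))) + ev (A (D f)) by exact: linearP.
rewrite IHA addr0.
have [g ->] : exists g, B (D f) = D g.
  by case: hB => [->|[y' ->]]; [exists f|apply: stab].
by rewrite IHk ?scaler0 // vsE.
Qed.

Definition ev_lift d D := exists2 u, envel_filt d u & forall f, ev (D f) = ev (J u f).

Lemma ev_lift_lin d c D E : ev_lift d D -> ev_lift d E -> ev_lift d (c *: D + E).
Proof.
move=> [u hu Du] [v hv Ev]; exists (c *: u + v); first exact/lspanD/hv/lspanZ.
have evE (g g' : P) : ev (c *: g + g') = c *: ev g + ev g' by exact: linearP.
by move=> f; rewrite (J_linearE J) linEndD linEndZ !evE Du Ev.
Qed.

Lemma ev_lift0 d : ev_lift d 0.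
Proof.
exists 0 => [|f]; first exact: lspan0.
by have -> : J 0 = 0 by exact: linear0.
Qed.

(** The outermost derivative is replaced at [p] by minus the field of [psi w] and moved to the
    right. A field that survives acts first on [f], hence becomes a right factor [ugen y]. *)
Lemma ev_lift_pders d ws : (size ws <= d)%N -> ev_lift d (pders ws).
Proof.
elim: d ws => [|d IHd] [|w ws] //= wsd.
- exists 1 => [|f]; last by rewrite rmorph1 /pders big_nil.
  by have := envel_filt_cst (@sbracket F L) 1; rewrite scale1r.
- exists 1 => [|f]; last by rewrite rmorph1 /pders big_nil.
  by have := envel_filtW (leq0n d.+1) (envel_filt_cst (@sbracket F L) 1); rewrite scale1r.
have [u hu uE] : ev_lift d.+1 (pact (j (psi w)) * pders ws).
  elim/lspan_ind: (pact_pders act_rep j_homog (psi w) ws) => [|c _ A [vs [B [vsE hB ->]]]].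
    exact: ev_lift0.
  apply: ev_lift_lin; have [|u hu uE] := IHd vs; first by rewrite vsE.
  case: hB => [->|[y ->]].
    by exists u => [|f]; [apply: envel_filtW hu | rewrite mulr1].
  exists (u * ugen y) => [|f]; last by rewrite linEndM uE (J_mulgen J_gen).
  by rewrite -addn1; apply: envel_filtM hu (envel_filt_gen _ _).
exists (- u) => [|f]; first by rewrite -scaleN1r; apply: lspanZ.
have -> : J (- u) f = - J u f by have -> : J (- u) = - J u by exact: linearN.
by rewrite linearN /= -uE !linEndM (ev_pact act_rep) psiKV opprK pders_cons.
Qed.

Lemma ev_lift_PDfilt d D : PDfilt d D -> ev_lift d D.
Proof.
elim/lspan_ind=> [|c _ E [f [b [hb ->]]] IHE]; first exact: ev_lift0.
apply: (ev_lift_lin) IHE.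
(* At [p] the coefficient [f] matters only through its value. *)
suff [u hu uE] : ev_lift d (partial b).
  exists ((ev f : F) *: u) => [|g]; first exact: lspanZ.
  have -> : J ((ev f : F) *: u) g = (ev f : F) *: J u g.
    by have -> : J ((ev f : F) *: u) = (ev f : F) *: J u by exact: linearZ.
  by rewrite linEndM mulopE [LHS]rmorphM [RHS]linearZ /= uE.
elim/lspan_ind: hb => [|k _ b' [s [sd ->]] IHb'].
  have -> : partial (0 : ssym W) = 0 by exact: linear0.
  exact: ev_lift0.
have -> : partial (k *: \prod_(x <- s) sgen x + b') =
  k *: partial (\prod_(x <- s) sgen x) + partial b' by exact: linearP.
by apply: ev_lift_lin IHb'; rewrite partial_prod; apply: ev_lift_pders.
Qed.

(** The Leibniz rule brings the field past the coefficient [f]; expanded by [superder_pder], it then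
    adds one derivative. *)
Lemma PDfilt_pact d a (x : G) D : homog a x -> PDfilt d D -> PDfilt d.+1 (pact x * D).
Proof.
move=> hx; have [I [par [e [phi frm]]]] := homog_frame_exists W.
have xder := pact_superder act_rep hx.
have xE := superder_pder frm xder (pact_op_homog act_rep hx).
elim/lspan_ind=> [|c _ E [f [b [hb ->]]] IHE]; first by rewrite mulr0; apply: lspan0.
rewrite mulrDr -scalerAr; apply/lspanD/IHE/lspanZ.
have -> : pact x * (mulop f * partial b) =
    mulop (pact x f) * partial b + mulop (stw a f) * (pact x * partial b).
  by apply: linEnd_ext => g; rewrite linEndD !linEndM !mulopE (superderM _ _ xder).
apply: lspanD.
  by apply: lspan_mem; exists (pact x f), b; split=> //; apply: envel_filtW hb.
rewrite [X in _ * (X * _)]xE mulr_suml mulr_sumr; apply: lspan_sum => i.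
rewrite -scalerAl -scalerAr; apply/lspanZ/lspan_mem.
exists (stw a f * pact x (sgen (phi i))), (sgen (e i) * b); split.
  by rewrite -add1n; apply: envel_filtM (envel_filt_gen _ _) hb.
have -> : partial (sgen (e i) * b) = pder (e i) * partial b.
  by rewrite [LHS]rmorphM /=; congr (_ * _); exact: envel_lift_gen.
by apply: linEnd_ext => g; rewrite !linEndM !mulopE mulrA.
Qed.

Lemma J_PDfilt d u : envel_filt d u -> PDfilt d (J u).
Proof.
have J0 : J 0 = 0 by exact: linear0.
elim/lspan_ind=> [|c _ v [s [sd ->]] IHv]; first by rewrite J0; apply: lspan0.
have -> : J (c *: \prod_(x <- s) envel_gen (@sbracket F L) x + v) =
  c *: J (\prod_(x <- s) envel_gen (@sbracket F L) x) + J v by exact: linearP.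
apply/lspanD/IHv/lspanZ; elim: s d sd {IHv} => [|x s IHs] d sd.
  rewrite big_nil rmorph1; apply: lspan_mem; exists 1, 1; split; last first.
    by rewrite rmorph1 mulr1; apply: linEnd_ext => g; rewrite mulopE mul1r.
  have := envel_filtW (leq0n d) (envel_filt_cst (fun _ _ : W => 0) 1).
  by rewrite scale1r.
case: d sd => // d sd; rewrite big_cons -[x]hpartD linearD mulrDl linearD.
have hom a : PDfilt d.+1 (J (ugen (hpart a x) * \prod_(y <- s) envel_gen (@sbracket F L) y)).
  have -> : J (ugen (hpart a x) * \prod_(y <- s) envel_gen (@sbracket F L) y) =
    J (ugen (hpart a x)) * J (\prod_(y <- s) envel_gen (@sbracket F L) y).
    exact: rmorphM.
  rewrite J_gen; apply: PDfilt_pact (IHs _ _) => //.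
  exact/j_homog/homog_hpart.
by apply: lspanD; apply: hom.
Qed.

Lemma J_op_homog a u : envel_homog a u -> op_homog a (J u).
Proof.
have JM v z f : J (v * z) f = J v (J z f).
  by have -> : J (v * z) = J v * J z by exact: rmorphM.
elim=> {a u} [a x hx|c|a|a u v _ IHu _ IHv|a b u v _ IHu _ IHv] b' f hf.
- have -> : J (envel_gen (@sbracket F L) x) = pact (j x) by exact: J_gen.
  by apply: pact_op_homog hf => //; apply: j_homog.
- by rewrite (J_cst J) addFb; apply: envel_homogZ.
- have -> : J 0 = 0 by exact: linear0.
  exact: envel_homog0.
- rewrite -[u]scale1r (J_linearE J) scale1r; apply: envel_homogD; first exact: IHu.
  exact: IHv.
- by rewrite JM -addbA; apply/IHu/IHv.
Qed.

Lemma J_comm a b u (y : M) : envel_homog b u -> homog a y ->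
  J u * pact (j' y) = (-1) ^+ (b && a) *: (pact (j' y) * J u).
Proof.
move=> hu hy; elim: hu => {b u} [b x hx|c|b|b u v _ IHu _ IHv|b c u v _ IHu _ IHv].
- have -> : J (envel_gen (@sbracket F L) x) = pact (j x) by exact: J_gen.
  by apply: pact_comm; [apply: j_homog|apply: j'_homog|apply: jj'].
- have -> : J c%:A = c%:A by rewrite [LHS]linearZ /= rmorph1.
  by rewrite scale1r -scalerAl -scalerAr mulr1 mul1r.
- have -> : J 0 = 0 by exact: linear0.
  by rewrite mul0r mulr0 scaler0.
- have -> : J (u + v) = J u + J v by exact: linearD.
  by rewrite mulrDl mulrDr scalerDr IHu IHv.
- have -> : J (u * v) = J u * J v by exact: rmorphM.
  by rewrite -mulrA IHv -scalerAr mulrA IHu -scalerAl scalerA -mulrA sign_andDl mulrC.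
Qed.

Lemma F_two_neq0 : (2 : F) != 0.
Proof. by rewrite (GRing.pcharf0P _).1. Qed.

Lemma op_homog_uniq D : op_homog false D -> op_homog true D -> D = 0.
Proof.
move=> D0 D1; apply: linEnd_ext => f; rewrite [RHS](_ : _ = 0) //.
have hom a g : envel_homog a g -> D g = 0.
  move=> hg; have := D0 _ _ hg; have := D1 _ _ hg.
  case: a {hg} => /= h1 h0.
    exact: (envel_homog_uniq (@zero_bracket_homog F (sdual W)) F_two_neq0).
  exact: (envel_homog_uniq (@zero_bracket_homog F (sdual W)) F_two_neq0).
have [f0 [f1 [h0 h1 -> _]]] := ssymP f.
by rewrite linearD /= (hom _ _ h0) (hom _ _ h1) addr0.
Qed.

Lemma op_homogB a D E : op_homog a D -> op_homog a E -> op_homog a (D - E).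
Proof.
move=> hD hE b f hf; have -> : (D - E) f = D f + (-1) *: E f by rewrite scaleN1r.
by apply: envel_homogD; [apply: hD|apply/envel_homogZ/hE].
Qed.

(** As [ev] kills odd polynomials, on even [f] only the even operators contribute, and on odd [f]
    only the odd ones. *)
Lemma ev_homog_split D0 D1 E0 E1 :
  op_homog false D0 -> op_homog true D1 -> op_homog false E0 -> op_homog true E1 ->
  (forall f, ev ((D0 + D1) f) = ev ((E0 + E1) f)) ->
  (forall f, ev (D0 f) = ev (E0 f)) /\ (forall f, ev (D1 f) = ev (E1 f)).
Proof.
move=> hD0 hD1 hE0 hE1 DE.
have evD (g h : P) : ev (g + h) = ev g + ev h by exact: linearD.
have linD D (g h : P) : D (g + h) = D g + D h by exact: linearD.
split=> f; have [f0 [f1 [h0 h1 -> _]]] := ssymP f; rewrite !linD !evD.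
  have := DE f0; rewrite !linEndD !evD.
  rewrite (ev_odd p_even (hD1 _ _ h0)) (ev_odd p_even (hE1 _ _ h0)) !addr0 => ->.
  by rewrite (ev_odd p_even (hD0 _ _ h1)) (ev_odd p_even (hE0 _ _ h1)).
have := DE f1; rewrite !linEndD !evD.
rewrite (ev_odd p_even (hD0 _ _ h1)) (ev_odd p_even (hE0 _ _ h1)) !add0r => ->.
by rewrite (ev_odd p_even (hD1 _ _ h0)) (ev_odd p_even (hE1 _ _ h0)).
Qed.

(** For an element [j x + j' y] of [G], centrality of [z] handles [x], and supercommutation of the
    two factors handles [y]. *)
Lemma J_ucenter_filt d z : ucenter_filt d z -> PDfilt_inv act d (J z).
Proof.
case=> -[z0 [z1 [h0 h1 zE zC]]] hz; split; first exact: J_PDfilt.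
exists (J z0), (J z1); split; [exact: J_op_homog|exact: J_op_homog| |].
  by rewrite zE; exact: linearD.
move=> a _ [g _ <-] hg.
(* Only the operator [pact g] is known to be homogeneous, not [g]. The part of [g] of the other
   parity acts by an operator of both parities, that is, by 0. *)
have ->: pact g = pact (hpart a g).
  have E : pact g = pact (hpart a g) + pact (hpart (~~ a) g).
    by rewrite -pactD //; congr pact; rewrite -{1}[g]hpartD; case: (a) => //; rewrite addrC.
  suff -> : pact g = pact g - pact (hpart (~~ a) g) by rewrite {1}E addrK.
  have hN := pact_op_homog act_rep (homog_hpart (~~ a) g).
  have hN' : op_homog a (pact (hpart (~~ a) g)).
    have -> : pact (hpart (~~ a) g) = pact g - pact (hpart a g) by rewrite E addrC addKr.
    exact: op_homogB hg (pact_op_homog act_rep (homog_hpart a g)).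
  rewrite (_ : pact (hpart (~~ a) g) = 0) ?subr0 //.
  by case: (a) hN hN' => hN hN'; apply: op_homog_uniq.
have [x [y [hx hy ->]]] := jD (homog_hpart a g).
rewrite pactD // -J_gen; have [c0 c1] := zC a (ugen x) I (envel_homog_gen _ hx).
have JM u v : J (u * v) = J u * J v by exact: rmorphM.
have JZ k u : J (k *: u) = k *: J u by exact: linearZ.
split; rewrite mulrDl mulrDr.
  by rewrite -!JM c0 (J_comm h0 hy) scale1r.
by rewrite -!JM c1 JZ (J_comm h1 hy) scalerDr.
Qed.

(** The functional of [D] is that of some [u] in [U^d(L)]. In each parity the difference of [D] and
    [J u] supercommutes with the second factor and has functional 0, so it vanishes. Supercommuting
    with the first factor then makes [u] central, since [J] is injective. *)
Lemma PDfilt_inv_image d D : PDfilt_inv act d D -> exists2 z, ucenter_filt d z & J z = D.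
Proof.
case=> hD [D0 [D1 [hD0 hD1 DE DC]]].
have [u hu uE] := ev_lift_PDfilt hD.
have [u0 [u1 [h0 h1 Eu f0 f1]]] :=
  envel_filt_homog (@sbracket_homog F L) F_two_neq0 hu.
have JD v w : J (v + w) = J v + J w by exact: linearD.
have JM v w : J (v * w) = J v * J w by exact: rmorphM.
have JZ k v : J (k *: v) = k *: J v by exact: linearZ.
have [e0 e1] : (forall f, ev (D0 f) = ev (J u0 f)) /\ (forall f, ev (D1 f) = ev (J u1 f)).
  apply: ev_homog_split => //; try exact: J_op_homog.
  by move=> f; rewrite -DE -JD -Eu.
have Dcomm a (g : G) : homog a g ->
    D0 * pact g = pact g * D0 /\ D1 * pact g = (-1) ^+ a *: (pact g * D1).
  by move=> hg; apply: DC (pact_op_homog act_rep hg) => //; exists g.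
have evB A B f : ev ((A - B) f) = ev (A f) - ev (B f) by exact: (linearB ev).
have E0 : D0 = J u0.
  apply/eqP; rewrite -subr_eq0; apply/eqP; apply: eq0_of_ev => [y f|f]; last first.
    by rewrite evB e0 subrr.
  exists (pact (j' y) f); elim/super_ind: y => [y y' IH IH'|a y hy].
    have -> : j' (y + y') = j' y + j' y' by exact: linearD.
    by rewrite pactD // !linEndD IH IH' -linearD.
  have := J_comm h0 hy; rewrite scale1r => c0.
  rewrite -!linEndM mulrBr mulrBl; congr ((_ - _) f); last by rewrite c0.
  by rewrite (Dcomm _ _ (j'_homog hy)).1.
have E1 : D1 = J u1.
  apply/eqP; rewrite -subr_eq0; apply/eqP; apply: eq0_of_ev => [y f|f]; last first.
    by rewrite evB e1 subrr.
  (* Moving an odd operator past the field of [y] costs [(-1)^|y|], which the twist of [y]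
     absorbs. *)
  exists (pact (j' (ptw true y)) f); elim/super_ind: y => [y y' IH IH'|a y hy].
    have -> : ptw true (y + y') = ptw true y + ptw true y' by exact: linearD.
    have j'D (v w : M) : j' (v + w) = j' v + j' w by exact: linearD.
    by rewrite (j'D y) (j'D (ptw true y)) !pactD // !linEndD IH IH' -linearD.
  have opE : pact (j' y) * (D1 - J u1) = (-1) ^+ a *: ((D1 - J u1) * pact (j' y)).
    rewrite mulrBr mulrBl scalerBr (J_comm h1 hy) (Dcomm _ _ (j'_homog hy)).2.
    by rewrite !scalerA -!signr_addb /= !addbb !scale1r.
  have -> : j' (ptw true y) = (-1) ^+ a *: j' y.
    by rewrite (ptw_homog _ hy); exact: linearZ.
  rewrite pactZ // linEndZ linearZ; exact: (congr1 (fun A : linEnd P => A f) opE).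
have [I [par [e [phi frm]]]] := homog_frame_exists W.
have inj v : J v = 0 -> v = 0.
  move=> Jv; apply: (@ev_J_eq0 _ _ _ _ _ _ act_rep j_homog _ J_gen _ p_even _ psi_homog
    psiK _ _ _ _ frm F0) => f.
  by rewrite Jv; exact: linear0.
exists u; last by rewrite Eu JD -E0 -E1 -DE.
split=> //; exists u0, u1; split=> // a x _ hx.
(* For generators both identities hold after applying [J], hence in U(L); they pass to sums and
   products. *)
have: u0 * x = x * u0 /\ u1 * x = (-1) ^+ a *: (x * u1).
  elim: hx => {a x} [a x hx|c|a|a x y _ [x0 x1] _ [y0 y1]|a b x y _ [x0 x1] _ [y0 y1]].
  - have [c0 c1] := Dcomm _ _ (j_homog hx).
    have xE : J (envel_gen (@sbracket F L) x) = pact (j x) by exact: J_gen.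
    split; apply/eqP; rewrite -subr_eq0 -scaleN1r; apply/eqP/inj.
      by rewrite JD JZ !JM xE -E0 c0 scaleN1r subrr.
    by rewrite JD !JZ !JM xE -E1 c1 scaleN1r subrr.
  - by rewrite scale1r -!scalerAl -!scalerAr !mulr1 !mul1r.
  - by rewrite !mulr0 !mul0r scaler0.
  - by rewrite !mulrDl !mulrDr scalerDr x0 x1 y0 y1.
  - split; first by rewrite mulrA x0 -mulrA y0 mulrA.
    by rewrite mulrA x1 -scalerAl -mulrA y1 -scalerAr scalerA mulrA signr_addb.
by [].
Qed.

End Prehomogeneous.

(** * The two factors of gl(V) x gl(V) *)

Section ZeroBracket.
Variables (F : fieldType) (L : lieSuperType F).

Lemma sbracket0l (x : L) : sbracket 0 x = 0.
Proof. by have := sbracketPl (-1) (0 : L) 0 x; rewrite !scaleN1r oppr0 addr0 addNr. Qed.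

Lemma sbracket0r (x : L) : sbracket x 0 = 0.
Proof. by have := sbracketPr (-1) x (0 : L) 0; rewrite !scaleN1r oppr0 addr0 addNr. Qed.

End ZeroBracket.

Section GlInstance.
Variables (F : fieldType) (m n : nat).
Local Notation L := (gl F m n).
Local Notation W := (wtens F m n).
Local Notation G := (L * L)%type.

(** The base point: the first factor sends it to [x] and the second to [- y], so each acts simply
    transitively there. *)
Definition wtens_id : W := 1%:M.

Lemma wtens_id_even : homog false wtens_id.
Proof.
apply/homog_mxP => i k ik; rewrite mxE; case: eqP => // ikE.
by rewrite ikE addbb in ik.
Qed.

Definition gl_inl (x : L) : G := (x, 0).
Fact gl_inl_linear : linear gl_inl.
Proof. by move=> c x y; congr pair; rewrite /= scaler0 addr0. Qed.
HB.instance Definition _ := GRing.isLinear.Build F L G *:%R gl_inl gl_inl_linear.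

Definition gl_inr (y : L) : G := (0, y).
Fact gl_inr_linear : linear gl_inr.
Proof. by move=> c x y; congr pair; rewrite /= scaler0 addr0. Qed.
HB.instance Definition _ := GRing.isLinear.Build F L G *:%R gl_inr gl_inr_linear.

Lemma gl_inl_homog a x : homog a x -> homog a (gl_inl x).
Proof. by move=> hx; apply/homog_pair; split=> //; apply: homog0. Qed.

Lemma gl_inr_homog a y : homog a y -> homog a (gl_inr y).
Proof. by move=> hy; apply/homog_pair; split=> //; apply: homog0. Qed.

Lemma gl_inlr_bracket x y : sbracket (gl_inl x) (gl_inr y) = 0.
Proof. by congr pair; rewrite /= ?sbracket0l ?sbracket0r. Qed.

Lemma gl_inrl_bracket y x : sbracket (gl_inr y) (gl_inl x) = 0.
Proof. by congr pair; rewrite /= ?sbracket0l ?sbracket0r. Qed.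

Lemma gl_inlD a (g : G) : homog a g ->
  exists (x y : L), [/\ homog a x, homog a y & g = gl_inl x + gl_inr y].
Proof.
case: g => x y /homog_pair[hx hy]; exists x, y; split=> //.
by congr pair; rewrite /= ?addr0 ?add0r.
Qed.

Lemma gl_inrD a (g : G) : homog a g ->
  exists (y x : L), [/\ homog a y, homog a x & g = gl_inr y + gl_inl x].
Proof. by move=> /gl_inlD[x [y [hx hy ->]]]; exists y, x; rewrite addrC. Qed.

Lemma wact_inl_id x : wact (gl_inl x) wtens_id = x.
Proof.
rewrite (@wactE _ _ _ false false) ?mulmx0 ?scaler0 ?subr0 ?mulmx1 //.
  exact: homog0.
exact: wtens_id_even.
Qed.

Lemma wact_inr_id y : wact (gl_inr y) wtens_id = - y.
Proof.
elim/super_ind: y => [x y IHx IHy|a y hy].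
  have -> : gl_inr (x + y) = gl_inr x + gl_inr y by exact: linearD.
  by rewrite (actDl (wact_srep F m n)) IHx IHy -opprD.
rewrite (@wactE _ _ _ a false (gl_inr y) _ hy wtens_id_even) andbF scale1r mul0mx mul1mx.
exact: sub0r.
Qed.

(** Inverse of the orbit map of the first factor at the identity; [W] and [gl(V)] are the same
    graded matrix space. *)
Definition gl_psil (w : W) : L := w.
Fact gl_psil_linear : linear gl_psil. Proof. by []. Qed.
HB.instance Definition _ := GRing.isLinear.Build F W L *:%R gl_psil gl_psil_linear.

Definition gl_psir (w : W) : L := - (w : L).
Fact gl_psir_linear : linear gl_psir.
Proof. by move=> c x y; rewrite /gl_psir opprD scalerN. Qed.
HB.instance Definition _ := GRing.isLinear.Build F W L *:%R gl_psir gl_psir_linear.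

Lemma gl_psir_homog a w : homog a w -> homog a (gl_psir w).
Proof. by move=> hw; rewrite /homog /gl_psir linearN; congr (- _). Qed.

Hypothesis F0 : [pchar F] =i pred0.

Local Notation rhol := (@rho F m n \o uinl L (L := L)).
Local Notation rhor := (@rho F m n \o uinr L (M := L)).

Lemma rhol_gen x : rhol (ugen x) = pact (@wact F m n) (gl_inl x).
Proof. by rewrite /= /uinl envel_lift_gen; exact: rho_gen. Qed.

Lemma rhor_gen x : rhor (ugen x) = pact (@wact F m n) (gl_inr x).
Proof. by rewrite /= /uinr envel_lift_gen; exact: rho_gen. Qed.

Lemma rhol_ucenter_filt d z :
  ucenter_filt d z -> PDfilt_inv (@wact F m n) d (rhol z).
Proof.
apply: (J_ucenter_filt F0 (wact_srep F m n) gl_inl_homog gl_inr_homog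
  gl_inlr_bracket gl_inlD rhol_gen).
Qed.

Lemma rhor_ucenter_filt d z :
  ucenter_filt d z -> PDfilt_inv (@wact F m n) d (rhor z).
Proof.
apply: (J_ucenter_filt F0 (wact_srep F m n) gl_inr_homog gl_inl_homog
  gl_inrl_bracket gl_inrD rhor_gen).
Qed.

Lemma rhol_surj d D : PDfilt_inv (@wact F m n) d D ->
  exists2 z, ucenter_filt d z & rhol z = D.
Proof.
apply: (PDfilt_inv_image F0 (wact_srep F m n) gl_inl_homog gl_inr_homog
  gl_inlr_bracket rhol_gen wtens_id_even (psi := gl_psil)) => //.
- exact: wact_inl_id.
- exact: wact_inl_id.
- by move=> w; exists (- (w : L)); rewrite wact_inr_id opprK.
Qed.

Lemma rhor_surj d D : PDfilt_inv (@wact F m n) d D ->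
  exists2 z, ucenter_filt d z & rhor z = D.
Proof.
apply: (PDfilt_inv_image F0 (wact_srep F m n) gl_inr_homog gl_inl_homog
  gl_inrl_bracket rhor_gen wtens_id_even (psi := gl_psir)) => //.
- exact: gl_psir_homog.
- by move=> x; rewrite wact_inr_id; exact: opprK.
- by move=> w; rewrite wact_inr_id; exact: opprK.
- by move=> w; exists w; exact: wact_inl_id.
Qed.

End GlInstance.

(** * Specialization to the complex numbers *)

Local Open Scope complex_scope.

Theorem theoremB1 (R : realType) (m n d : nat) :
  let L : lieSuperType R[i] := gl R[i] m n in
  let Zd : set (uea L) := ucenter_filt d in
  let Zd_1 : set (uea (L * L)%type) := [set uinl L z | z in Zd] in
  let one_Zd : set (uea (L * L)%type) := [set uinr L z | z in Zd] in
  let PDdg : set (linEnd (spoly (wtens R[i] m n))) :=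
    PDfilt_inv (@wact R[i] m n) d in
  [/\ set_fun Zd_1 PDdg (@rho R[i] m n),
      set_surj Zd_1 PDdg (@rho R[i] m n),
      set_fun one_Zd PDdg (@rho R[i] m n)
    & set_surj one_Zd PDdg (@rho R[i] m n)].
Proof.
have F0 : [pchar R[i]] =i pred0 by exact: Num.Theory.pchar_num.
split=> [_ [z hz <-]|D hD|_ [z hz <-]|D hD].
- exact: rhol_ucenter_filt F0 _ _ hz.
- by have [z hz <-] := rhol_surj F0 hD; exists (uinl (gl R[i] m n) z) => //; exists z.
- exact: rhor_ucenter_filt F0 _ _ hz.
- by have [z hz <-] := rhor_surj F0 hD; exists (uinr (gl R[i] m n) z) => //; exists z.
Qed.
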